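(* Let $A=\mathrm{Sym}(\mathbf{C}\langle1\rangle)$, so that $A$-modules are functors from finite sets with injections to vector spaces, and let $\mathrm{Mod}_K$ be the Serre quotient of the category $\mathrm{Mod}_A^{\mathrm{fg}}$ of finitely generated $A$-modules by the subcategory $\mathrm{Mod}_A^{\mathrm{f}}$ of finite length modules, with quotient functor $T\colon\mathrm{Mod}_A^{\mathrm{fg}}\to\mathrm{Mod}_K$. Let $\Phi\colon\mathrm{Mod}_K\to\mathrm{Rep}(\mathfrak{S})$ be the exact functor induced by $T'$ (so $\Phi T=T'$), and let $\Psi=TS'\colon\mathrm{Rep}(\mathfrak{S})\to\mathrm{Mod}_K$. Then $\Phi$ and $\Psi$ are mutually quasi-inverse equivalences between $\mathrm{Mod}_K$ and $\mathrm{Rep}(\mathfrak{S})$.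
   Context: Everything is over $\mathbf{C}$. Let $\mathcal{B}=\{1,2,\dots\}$ and let $\mathfrak{S}=\mathfrak{S}(\infty)$ be the group of permutations of $\mathcal{B}$ fixing all but finitely many elements. It acts on $\mathbf{V}=\mathbf{C}^\infty$ by permuting the basis $\{e_i\}_{i\in\mathcal{B}}$. A representation of $\mathfrak{S}$ is algebraic if it is a subquotient of a finite direct sum of representations $\mathbf{V}^{\otimes n}$; $\mathrm{Rep}(\mathfrak{S})$ is the abelian category of these. $\mathrm{Mod}_A$: $A=\mathrm{Sym}(\mathbf{C}\langle1\rangle)$ is the twisted commutative algebra $\mathrm{Sym}(\mathbf{C}^\infty)$; its module category is identified with the category of functors $M$, $L\mapsto M_L$, from the category of finite sets and injections to $\mathrm{Vec}$. The functor $T'\colon\mathrm{Mod}_A^{\mathrm{fg}}\to\mathrm{Rep}(\mathfrak{S})$ is $T'(M)=\varinjlim_{L\subset\mathcal{B}}M_L$, the colimit over finite subsets $L$ of $\mathcal{B}$ and inclusions, with $\sigma\in\mathfrak{S}$ acting through the bijections $L\to\sigma(L)$. It is exact and kills finite length modules. The functor $S'\colon\mathrm{Rep}(\mathfrak{S})\to\mathrm{Mod}_A^{\mathrm{fg}}$: for a finite set $L$ of cardinality $d$, $S'(M)_L=M^{H_d}$ after choosing a bijection $L\cong\{1,\dots,d\}$, where $H_d\subset\mathfrak{S}$ is the subgroup fixing $1,\dots,d$. Canonically, $S'(M)_L$ is the space of families $(m_\iota)$ indexed by injections $\iota\colon L\to\mathcal{B}$, with $m_\iota\in M$ invariant under the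 subgroup fixing $\iota(L)$ pointwise and $m_{\sigma\iota}=\sigma m_\iota$ for $\sigma\in\mathfrak{S}$; an injection $f\colon L\to L'$ sends $(m_\iota)_\iota$ to $(m_{\iota'f})_{\iota'}$. *)

(* Defs.v *)
From HB Require Import structures.
From mathcomp Require Import all_boot all_order all_algebra.
From mathcomp Require Import finmap generic_quotient.
From mathcomp Require Import boolp classical_sets functions reals complex freeg.

Set Implicit Arguments.
Unset Strict Implicit.
Unset Printing Implicit Defensive.

Import GRing.Theory.

Local Open Scope ring_scope.
Local Open Scope quotient_scope.

Local Obligation Tactic := idtac.

(** Hom-sets are setoids: two morphisms are identified when [heq] relates them.
    Laws of categories and functors hold up to [heq]. *)
Record category := Category {
  ob :> Type;
  hom : ob -> ob -> Type;
  heq : forall x y, hom x y -> hom x y -> Prop;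
  idc : forall x, hom x x;
  compc : forall x y z, hom y z -> hom x y -> hom x z;
  heq_refl : forall x y (f : hom x y), heq f f;
  heq_sym : forall x y (f g : hom x y), heq f g -> heq g f;
  heq_trans : forall x y (f g h : hom x y), heq f g -> heq g h -> heq f h;
  comp_heq : forall x y z (g g' : hom y z) (f f' : hom x y),
    heq g g' -> heq f f' -> heq (compc g f) (compc g' f');
  compA : forall x y z t (h : hom z t) (g : hom y z) (f : hom x y),
    heq (compc h (compc g f)) (compc (compc h g) f);
  comp_idl : forall x y (f : hom x y), heq (compc (idc y) f) f;
  comp_idr : forall x y (f : hom x y), heq (compc f (idc x)) f }.

Arguments hom {c} _ _.
Arguments heq {c x y} _ _.
Arguments idc {c} x.
Arguments compc {c x y z} _ _.

Record functor (C D : category) := Functor {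
  fob :> C -> D;
  fmor : forall x y : C, hom x y -> hom (fob x) (fob y);
  fmor_heq : forall (x y : C) (f g : hom x y), heq f g -> heq (fmor f) (fmor g);
  fmor_id : forall x : C, heq (fmor (idc x)) (idc (fob x));
  fmor_comp : forall (x y z : C) (g : hom y z) (f : hom x y),
    heq (fmor (compc g f)) (compc (fmor g) (fmor f)) }.

Arguments fmor {C D} _ {x y} _.

Section FunctorOps.
Variables C D E : category.

Program Definition functor_id : functor C C :=
  @Functor C C (fun x => x) (fun x y f => f) _ _ _.
Next Obligation. by []. Qed.
Next Obligation. by move=> x; exact: heq_refl. Qed.
Next Obligation. by move=> x y z g f; exact: heq_refl. Qed.

Program Definition functor_comp (G : functor D E) (F : functor C D) :
    functor C E :=
  @Functor C E (fun x => G (F x)) (fun x y f => fmor G (fmor F f)) _ _ _.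
Next Obligation. by move=> G F x y f g fg; do 2!apply: fmor_heq. Qed.
Next Obligation.
move=> G F x; apply: heq_trans (fmor_id G _).
exact/fmor_heq/fmor_id.
Qed.
Next Obligation.
move=> G F x y z g f; apply: heq_trans (fmor_comp G _ _).
exact/fmor_heq/fmor_comp.
Qed.

End FunctorOps.

Definition nat_iso (C D : category) (F G : functor C D) : Prop :=
  exists (a : forall x, hom (F x) (G x)) (b : forall x, hom (G x) (F x)),
    [/\ forall x y (f : hom x y),
          heq (compc (a y) (fmor F f)) (compc (fmor G f) (a x)),
        forall x, heq (compc (b x) (a x)) (idc (F x))
      & forall x, heq (compc (a x) (b x)) (idc (G x))].

Definition mutually_quasi_inverse (C D : category)
    (F : functor C D) (G : functor D C) : Prop :=
  nat_iso (functor_comp F G) (functor_id D) /\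
  nat_iso (functor_comp G F) (functor_id C).

Section FullSubcategory.

Program Definition full_sub (C : category) (P : C -> Prop) : category :=
  @Category {x : C | P x} (fun x y => hom (sval x) (sval y))
    (fun x y f g => heq f g) (fun x => idc (sval x))
    (fun x y z g f => compc g f) _ _ _ _ _ _ _.
Next Obligation. by move=> C P x y f; exact: heq_refl. Qed.
Next Obligation. by move=> C P x y f g; exact: heq_sym. Qed.
Next Obligation. by move=> C P x y f g h; exact: heq_trans. Qed.
Next Obligation. by move=> C P x y z g g' f f'; exact: comp_heq. Qed.
Next Obligation. by move=> C P x y z t h g f; exact: compA. Qed.
Next Obligation. by move=> C P x y f; exact: comp_idl. Qed.
Next Obligation. by move=> C P x y f; exact: comp_idr. Qed.

Variables (C D : category) (P : C -> Prop) (Q : D -> Prop).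
Variables (F : functor C D) (PQ : forall x, P x -> Q (F x)).

Program Definition functor_restrict : functor (full_sub P) (full_sub Q) :=
  @Functor (full_sub P) (full_sub Q)
    (fun x => exist Q (F (sval x)) (PQ (svalP x)))
    (fun x y f => fmor F f) _ _ _.
Next Obligation. by move=> x y f g; exact: (@fmor_heq _ _ F). Qed.
Next Obligation. by move=> x; exact: (@fmor_id _ _ F). Qed.
Next Obligation. by move=> x y z g f; exact: (@fmor_comp _ _ F). Qed.

End FullSubcategory.

Record inj (A B : Type) := Inj { ifun :> A -> B; inj_inj : injective ifun }.

Definition fi_id (A : Type) : inj A A := Inj (@inj_id A).

Definition fi_comp (A B C : Type) (g : inj B C) (f : inj A B) : inj A C :=
  Inj (inj_comp (@inj_inj _ _ g) (@inj_inj _ _ f)).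

Lemma inj_ext (A B : Type) (f g : inj A B) : f =1 g -> f = g.
Proof.
case: f g => [f fi] [g gi] /= /funext fg.
by case: _ / fg in gi *; congr Inj; exact: Prop_irrelevance.
Qed.

Section Linear.
Variables (k : fieldType) (U V : lmodType k) (f : U -> V) (f_lin : linear f).

HB.instance Definition _ := GRing.isLinear.Build k U V *:%R f f_lin.

Definition mk_linear : {linear U -> V} := f.

End Linear.

Section Main.
Variable k : fieldType.

(** An $A$-module, as a functor from finite sets with injections. *)
Record FImod := FIMod {
  fi_ob :> finType -> lmodType k;
  fi_map : forall L L' : finType, inj L L' -> {linear fi_ob L -> fi_ob L'};
  fi_map_id : forall (L : finType) (x : fi_ob L), fi_map (fi_id L) x = x;
  fi_map_comp : forall (L L' L'' : finType) (g : inj L' L'') (f : inj L L')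
    (x : fi_ob L), fi_map (fi_comp g f) x = fi_map g (fi_map f x) }.

Arguments fi_map _ {L L'} _.

Record FIhom (M N : FImod) := FIHom {
  fih :> forall L, {linear M L -> N L};
  fih_nat : forall (L L' : finType) (f : inj L L') (x : M L),
    fih L' (fi_map M f x) = fi_map N f (fih L x) }.

Program Definition FIhom_id (M : FImod) : FIhom M M :=
  @FIHom M M (fun L => idfun) _.
Next Obligation. by []. Qed.

Program Definition FIhom_comp (M N P : FImod) (g : FIhom N P) (f : FIhom M N) :
    FIhom M P :=
  @FIHom M P (fun L => g L \o f L) _.
Next Obligation. by move=> M N P g f L L' h x /=; rewrite !fih_nat. Qed.

Program Definition ModA : category :=
  @Category FImod FIhom (fun M N f g => forall L, f L =1 g L)
    FIhom_id FIhom_comp _ _ _ _ _ _ _.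
Next Obligation. by []. Qed.
Next Obligation. by move=> M N f g fg L x; rewrite fg. Qed.
Next Obligation. by move=> M N f g h fg gh L x; rewrite fg gh. Qed.
Next Obligation. by move=> M N P g g' f f' gg ff L x /=; rewrite ff gg. Qed.
Next Obligation. by []. Qed.
Next Obligation. by []. Qed.
Next Obligation. by []. Qed.

Record submod (M : FImod) := Submod {
  sm :> forall L, M L -> Prop;
  sm0 : forall L, sm (0 : M L);
  smD : forall L (x y : M L), sm x -> sm y -> sm (x + y);
  smZ : forall L (a : k) (x : M L), sm x -> sm (a *: x);
  sm_map : forall (L L' : finType) (f : inj L L') (x : M L), sm x -> sm (fi_map M f x) }.

Definition sub (M : FImod) (A B : submod M) : Prop :=
  forall L (x : M L), A L x -> B L x.

Program Definition sm_full (M : FImod) : submod M :=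
  @Submod M (fun L x => True) _ _ _ _.
Solve All Obligations with by [].

Program Definition sm_zero (M : FImod) : submod M :=
  @Submod M (fun L x => x = 0) _ _ _ _.
Next Obligation. by []. Qed.
Next Obligation. by move=> M L x y -> ->; rewrite addr0. Qed.
Next Obligation. by move=> M L a x ->; rewrite scaler0. Qed.
Next Obligation. by move=> M L L' f x ->; rewrite linear0. Qed.

Definition finitely_generated (M : FImod) : Prop :=
  exists (r : nat) (L : 'I_r -> finType) (g : forall i, M (L i)),
    forall X : submod M, (forall i, X (L i) (g i)) -> sub (sm_full M) X.

Definition ModA_fg : category := @full_sub ModA finitely_generated.

(** [B / A] is simple. *)
Definition simple_step (M : FImod) (A B : submod M) : Prop :=
  [/\ sub A B, ~ sub B A
    & forall C : submod M, sub A C -> sub C B -> sub C A \/ sub B C].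

(** [A] is contained in [B], and [B / A] has a composition series. *)
Inductive finite_length (M : FImod) : submod M -> submod M -> Prop :=
| finite_length0 (A B : submod M) : sub A B -> sub B A -> finite_length A B
| finite_lengthS (A B C : submod M) :
    finite_length A B -> simple_step B C -> finite_length A C.

Lemma finite_length_trans M (A B C : submod M) :
  finite_length A B -> finite_length B C -> finite_length A C.
Proof.
move=> AB BC; elim: BC A AB => {B C}[B C BC CB|B C D BC IH CD] A AB.
  case: AB BC CB => {A B}[A B AB BA|A B0 B AB0 [s1 s2 s3]] BC CB.
    by apply: finite_length0 => L x; [move/AB/BC|move/CB/BA].
  apply: finite_lengthS AB0 _; split.
  - by move=> L x /s1/BC.
  - by move=> h; apply: s2 => L x /BC/h.
  - move=> E h1 h2; have [||h|h] := s3 E => //.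
    + by move=> L x /h2/CB.
    + by left.
    + by right => L x /CB/h.
exact: finite_lengthS (IH _ AB) CD.
Qed.

(** A linear relation from [M] to [N], i.e. a submodule of $M \oplus N$. *)
Record lrel (M N : FImod) := LRel {
  lr :> forall L, M L -> N L -> Prop;
  lr0 : forall L, lr (0 : M L) 0;
  lrD : forall L (m m' : M L) (n n' : N L),
    lr m n -> lr m' n' -> lr (m + m') (n + n');
  lrZ : forall L (a : k) (m : M L) (n : N L), lr m n -> lr (a *: m) (a *: n);
  lr_map : forall (L L' : finType) (f : inj L L') (m : M L) (n : N L),
    lr m n -> lr (fi_map M f m) (fi_map N f n) }.

Lemma lrB M N (G : lrel M N) L (m m' : M L) (n n' : N L) :
  G L m n -> G L m' n' -> G L (m - m') (n - n').
Proof.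
move=> mn mn'; apply: lrD => //.
by have := lrZ (-1) mn'; rewrite !scaleN1r.
Qed.

Lemma smB M (A : submod M) L (x y : M L) : A L x -> A L y -> A L (x - y).
Proof.
by move=> Ax Ay; apply: smD => //; have := smZ (-1) Ay; rewrite scaleN1r.
Qed.

Program Definition lr_pre M N (G : lrel M N) (X : submod N) : submod M :=
  @Submod M (fun L m => exists2 n, X L n & G L m n) _ _ _ _.
Next Obligation. by move=> *; exists 0; [exact: sm0|exact: lr0]. Qed.
Next Obligation.
move=> M N G X L x y [n Xn Gn] [n' Xn' Gn'].
by exists (n + n'); [exact: smD|exact: lrD].
Qed.
Next Obligation.
by move=> M N G X L a x [n Xn Gn]; exists (a *: n); [exact: smZ|exact: lrZ].
Qed.
Next Obligation.
move=> M N G X L L' f x [n Xn Gn].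
by exists (fi_map N f n); [exact: sm_map|exact: lr_map].
Qed.

Program Definition lr_conv M N (G : lrel M N) : lrel N M :=
  @LRel N M (fun L n m => G L m n) _ _ _ _.
Next Obligation. by move=> *; exact: lr0. Qed.
Next Obligation. by move=> *; exact: lrD. Qed.
Next Obligation. by move=> *; exact: lrZ. Qed.
Next Obligation. by move=> *; exact: lr_map. Qed.

Program Definition lr_comp M N P (D : lrel N P) (G : lrel M N) : lrel M P :=
  @LRel M P (fun L m p => exists2 n, G L m n & D L n p) _ _ _ _.
Next Obligation. by move=> *; exists 0; exact: lr0. Qed.
Next Obligation.
by move=> M N P D G L m m' p p' [n ? ?] [n' ? ?]; exists (n + n'); exact: lrD.
Qed.
Next Obligation.
by move=> M N P D G L a m p [n ? ?]; exists (a *: n); exact: lrZ.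
Qed.
Next Obligation.
by move=> M N P D G L L' f m p [n ? ?]; exists (fi_map N f n); exact: lr_map.
Qed.

Program Definition lr_graph M N (f : FIhom M N) : lrel M N :=
  @LRel M N (fun L m n => n = f L m) _ _ _ _.
Next Obligation. by move=> * /=; rewrite linear0. Qed.
Next Obligation. by move=> M N f L m m' n n' /= -> ->; rewrite linearD. Qed.
Next Obligation. by move=> M N f L a m n /= ->; rewrite linearZ. Qed.
Next Obligation. by move=> M N f L L' g m n /= ->; rewrite fih_nat. Qed.

(** A relation [G] amounts to a linear map $f \colon M' \to N/N'$, where
    [M' = lr_dom G] and [N' = lr_ind G]: [G L m n] means that $m \in M'_L$ and
    that $f(m)$ is the class of $n$. *)
Definition lr_dom M N (G : lrel M N) : submod M := lr_pre G (sm_full N).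
Definition lr_ind M N (G : lrel M N) : submod N := lr_pre (lr_conv G) (sm_zero M).

Lemma lr_indE M N (G : lrel M N) L (n : N L) : lr_ind G L n <-> G L 0 n.
Proof. by split=> [[m /= ->]|h] //; exists 0. Qed.

Program Definition sm_between M N (G : lrel M N) (Y Z : submod N)
    (W : submod M) : submod N :=
  @Submod N (fun L y => exists x y' w,
    [/\ Y L x, Z L y', W L w, G L w y' & y = x + y']) _ _ _ _.
Next Obligation.
move=> M N G Y Z W L; exists 0, 0, 0; rewrite addr0.
by split=> //; [exact: sm0|exact: sm0|exact: sm0|exact: lr0].
Qed.
Next Obligation.
move=> M N G Y Z W L _ _ [x [y [w [? ? ? ? ->]]]] [x' [y' [w' [? ? ? ? ->]]]].
exists (x + x'), (y + y'), (w + w').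
by split; [exact: smD|exact: smD|exact: smD|exact: lrD|rewrite addrACA].
Qed.
Next Obligation.
move=> M N G Y Z W L a _ [x [y [w [? ? ? ? ->]]]].
exists (a *: x), (a *: y), (a *: w).
by split; [exact: smZ|exact: smZ|exact: smZ|exact: lrZ|rewrite scalerDr].
Qed.
Next Obligation.
move=> M N G Y Z W L L' f _ [x [y [w [? ? ? ? ->]]]].
exists (fi_map N f x), (fi_map N f y), (fi_map M f w).
split; [exact: sm_map|exact: sm_map|exact: sm_map|exact: lr_map|].
by rewrite linearD.
Qed.

Lemma finite_length_pre M N (G : lrel M N) (X Y : submod N) :
  finite_length X Y -> finite_length (lr_pre G X) (lr_pre G Y).
Proof.
elim=> {X Y}[X Y XY YX|X Y Z _ IH [YZ ZY YZs]].
  by apply: finite_length0 => L m [n Xn Gn]; exists n => //; [exact: XY|exact: YX].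
have sYZ : sub (lr_pre G Y) (lr_pre G Z).
  by move=> L m [n Xn Gn]; exists n => //; exact: YZ.
have [ZYp|nZY] := pselect (sub (lr_pre G Z) (lr_pre G Y)).
  by apply: finite_length_trans IH _; exact: finite_length0.
apply: finite_lengthS IH _; split=> // W YW WZ.
pose C := sm_between G Y Z W.
have [||CY|ZC] := YZs C.
- move=> L y Yy; exists y, 0, 0; rewrite addr0.
  by split=> //; [exact: sm0|exact: sm0|exact: lr0].
- move=> L _ [x [y [w [Yx Zy _ _ ->]]]]; apply: smD => //; exact: YZ.
- left=> L w Ww; have [y Zy Gy] := WZ _ _ Ww; exists y => //.
  apply: CY; exists 0, y, w; rewrite add0r; split=> //; exact: sm0.
- right=> L m [n Zn Gn].
  have [x [y [w [Yx Zy Ww Gw def_n]]]] := ZC _ _ Zn.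
  rewrite -[m](subrK w); apply: smD => //; apply: YW; exists x => //.
  by have := lrB Gn Gw; rewrite def_n addrK.
Qed.

Lemma finite_length_refl M (A : submod M) : finite_length A A.
Proof. exact: finite_length0. Qed.

Lemma finite_length_eq M (A A' B B' : submod M) :
  (forall L x, A L x <-> A' L x) -> (forall L x, B L x <-> B' L x) ->
  finite_length A B -> finite_length A' B'.
Proof.
move=> AA BB AB.
have fA : finite_length A' A by apply: finite_length0 => L x; rewrite AA.
have fB : finite_length B B' by apply: finite_length0 => L x; rewrite BB.
by apply: finite_length_trans fB; exact: finite_length_trans AB.
Qed.

Program Definition sm_cap M (A B : submod M) : submod M :=
  @Submod M (fun L x => A L x /\ B L x) _ _ _ _.
Next Obligation. by move=> *; split; exact: sm0. Qed.
Next Obligation. by move=> M A B L x y [? ?] [? ?]; split; exact: smD. Qed.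
Next Obligation. by move=> M A B L a x [? ?]; split; exact: smZ. Qed.
Next Obligation. by move=> M A B L L' f x [? ?]; split; exact: sm_map. Qed.

Program Definition sm_add M (A B : submod M) : submod M :=
  @Submod M (fun L x => exists2 a, A L a & B L (x - a)) _ _ _ _.
Next Obligation. by move=> *; exists 0; rewrite ?subr0; exact: sm0. Qed.
Next Obligation.
move=> M A B L x y [a Aa Ba] [b Ab Bb]; exists (a + b); first exact: smD.
by rewrite opprD addrACA; exact: smD.
Qed.
Next Obligation.
move=> M A B L c x [a Aa Ba]; exists (c *: a); first exact: smZ.
by rewrite -scalerBr; exact: smZ.
Qed.
Next Obligation.
move=> M A B L L' f x [a Aa Ba]; exists (fi_map M f a); first exact: sm_map.
by rewrite -linearB; exact: sm_map.
Qed.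

Lemma sm_addl M (A B : submod M) : sub A (sm_add A B).
Proof. by move=> L x Ax; exists x => //; rewrite subrr; exact: sm0. Qed.

Lemma sm_addr M (A B : submod M) : sub B (sm_add A B).
Proof. by move=> L x Bx; exists 0; rewrite ?subr0 //; exact: sm0. Qed.

Program Definition lr_diag M (A : submod M) : lrel M M :=
  @LRel M M (fun L m n => m = n /\ A L m) _ _ _ _.
Next Obligation. by move=> M A L; split=> //; exact: sm0. Qed.
Next Obligation.
by move=> M A L m m' n n' [-> ?] [-> ?]; split=> //; exact: smD.
Qed.
Next Obligation. by move=> M A L a m n [-> ?]; split=> //; exact: smZ. Qed.
Next Obligation.
by move=> M A L L' f m n [-> ?]; split=> //; exact: sm_map.
Qed.

Program Definition lr_coset M (A : submod M) : lrel M M :=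
  @LRel M M (fun L m n => A L (m - n)) _ _ _ _.
Next Obligation. by move=> M A L /=; rewrite subrr; exact: sm0. Qed.
Next Obligation.
by move=> M A L m m' n n' /= ? ?; rewrite opprD addrACA; exact: smD.
Qed.
Next Obligation. by move=> M A L a m n /= ?; rewrite -scalerBr; exact: smZ. Qed.
Next Obligation.
by move=> M A L L' f m n /= ?; rewrite -linearB; exact: sm_map.
Qed.

Lemma cofinite_cap M (A B : submod M) :
  finite_length A (sm_full M) -> finite_length B (sm_full M) ->
  finite_length (sm_cap A B) (sm_full M).
Proof.
move=> fA fB; apply: finite_length_trans fA.
apply: finite_length_eq (finite_length_pre (lr_diag A) fB) => L x; split.
- by case=> n Bn [-> An].
- by case=> Ax Bx; exists x.
- by case=> n Bn [-> An].
- by move=> Ax; exists x.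
Qed.

Lemma finite_add M (A B : submod M) :
  finite_length (sm_zero M) A -> finite_length (sm_zero M) B ->
  finite_length (sm_zero M) (sm_add A B).
Proof.
move=> fA fB; apply: finite_length_trans fA _.
apply: finite_length_eq (finite_length_pre (lr_coset A) fB) => L x; split.
- by case=> n /= ->; rewrite subr0.
- by move=> Ax; exists 0; rewrite /= ?subr0.
- by case=> n Bn An; exists (x - n) => //; rewrite opprB addrCA subrr addr0.
- by case=> a Aa Ba; exists (x - a) => //=; rewrite opprB addrCA subrr addr0.
Qed.

Lemma finite_img M N (G : lrel M N) (X : submod M) :
  finite_length (sm_zero M) X -> finite_length (sm_zero N) (lr_ind G) ->
  finite_length (sm_zero N) (lr_pre (lr_conv G) X).
Proof.
move=> fX fG; apply: finite_length_trans fG _; exact: finite_length_pre.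
Qed.

Lemma cofinite_pre M N (G : lrel M N) (X : submod N) :
  finite_length X (sm_full N) -> finite_length (lr_dom G) (sm_full M) ->
  finite_length (lr_pre G X) (sm_full M).
Proof. by move=> fX fG; apply: finite_length_trans fG; exact: finite_length_pre. Qed.

(** Morphisms in the Serre quotient are
    $\varinjlim \mathrm{Hom}(M', N/N')$ over the submodules $M'$ of $M$ with
    $M/M'$ of finite length and the submodules $N'$ of $N$ of finite length.  A
    representative is encoded by its linear relation; then composition in the
    Serre quotient is composition of relations.  ($M'$ is not required to be
    finitely generated, since $M$ is: $M$ is finite-dimensional in each degree
    and $M'$ agrees with $M$ in all large degrees.) *)
Record Kmor (M N : FImod) := KMor {
  krel :> lrel M N;
  krel_dom : finite_length (lr_dom krel) (sm_full M);
  krel_ind : finite_length (sm_zero N) (lr_ind krel) }.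

(** Equality in the colimit: both maps agree as maps $M' \to N/N'$ for some
    smaller $M'$ and larger $N'$.  (The case $m = 0$ of the last clause says that
    [N'] contains [lr_ind G] and [lr_ind G'].) *)
Definition Kmor_eq (M N : FImod) (G G' : Kmor M N) : Prop :=
  exists (M' : submod M) (N' : submod N),
    [/\ finite_length M' (sm_full M), finite_length (sm_zero N) N',
        sub M' (lr_dom G), sub M' (lr_dom G')
      & forall L (m : M L) (n n' : N L),
          M' L m -> G L m n -> G' L m n' -> N' L (n - n')].

Program Definition Kmor_of (M N : FImod) (f : FIhom M N) : Kmor M N :=
  @KMor M N (lr_graph f) _ _.
Next Obligation.
move=> M N f; apply: finite_length0 => // L x _; exists (f L x) => //.
Qed.
Next Obligation.
move=> M N f; apply: finite_length0 => L x.
  by move=> /= ->; exists 0; rewrite //= linear0.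
by move/lr_indE => /= ->; rewrite linear0.
Qed.

Program Definition Kmor_comp (M N P : FImod) (D : Kmor N P) (G : Kmor M N) :
    Kmor M P := @KMor M P (lr_comp D G) _ _.
Next Obligation.
move=> M N P D G.
have := cofinite_pre (krel_dom D) (krel_dom G).
apply: finite_length_eq => // L m; split.
  by move=> [n [p _ Dp] Gn]; exists p => //; exists n.
by move=> [p _ [n Gn Dp]]; exists n => //; exists p.
Qed.
Next Obligation.
move=> M N P D G.
have := finite_img (krel_ind G) (krel_ind D).
apply: finite_length_eq => // L p; split.
  by move=> [n /lr_indE Gn Dp]; apply/lr_indE; exists n.
by move=> /lr_indE [n Gn Dp]; exists n => //; apply/lr_indE.
Qed.

Lemma Kmor_eq_ext M N (G G' : Kmor M N) :
  (forall L m n, G L m n <-> G' L m n) -> Kmor_eq G G'.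
Proof.
move=> GG; exists (lr_dom G), (lr_ind G'); split=> //.
- exact: krel_dom.
- exact: krel_ind.
- by move=> L m [n _ /GG Gn]; exists n.
- move=> L m n n' _ /GG Gn Gn'; apply/lr_indE.
  by rewrite -(subrr m); exact: lrB.
Qed.

Lemma Kmor_eq_refl M N (G : Kmor M N) : Kmor_eq G G.
Proof. exact: Kmor_eq_ext. Qed.

Lemma Kmor_eq_sym M N (G G' : Kmor M N) : Kmor_eq G G' -> Kmor_eq G' G.
Proof.
move=> [M' [N' [fM fN d d' e]]]; exists M', N'; split=> // L m n n' Mm Gn Gn'.
rewrite -opprB -scaleN1r; apply: smZ; exact: e Gn' Gn.
Qed.

Lemma Kmor_eq_trans M N (G1 G2 G3 : Kmor M N) :
  Kmor_eq G1 G2 -> Kmor_eq G2 G3 -> Kmor_eq G1 G3.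
Proof.
move=> [M1 [N1 [fM1 fN1 d1 d1' e1]]] [M2 [N2 [fM2 fN2 d2 d2' e2]]].
exists (sm_cap M1 M2), (sm_add N1 N2); split.
- exact: cofinite_cap.
- exact: finite_add.
- by move=> L x [/d1].
- by move=> L x [_ /d2'].
- move=> L m n n' [m1 m2] G1n G3n'; have [n0 _ Gn0] := d2 _ _ m2.
  exists (n - n0); first exact: e1 m1 G1n Gn0.
  suff -> : n - n' - (n - n0) = n0 - n' by exact: e2 m2 Gn0 G3n'.
  by rewrite opprB addrC addrA subrK.
Qed.

Lemma Kmor_comp_eq M N P (D D' : Kmor N P) (G G' : Kmor M N) :
  Kmor_eq D D' -> Kmor_eq G G' -> Kmor_eq (Kmor_comp D G) (Kmor_comp D' G').
Proof.
move=> [N2 [P2 [fN2 fP2 d2 d2' e2]]] [M1 [N1 [fM1 fN1 d1 d1' e1]]].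
exists (sm_cap M1 (sm_cap (lr_pre G N2) (lr_pre G' N2))).
pose I1 := lr_pre (lr_conv D) (lr_ind G).
pose I2 := lr_pre (lr_conv D') (lr_ind G').
pose I3 := lr_pre (lr_conv D) N1.
exists (sm_add (sm_add I1 I2) (sm_add I3 P2)); split.
- do 2?apply: cofinite_cap => //; apply: cofinite_pre => //; exact: krel_dom.
- by do 2?apply: finite_add => //; apply: finite_img => //; exact: krel_ind.
- move=> L m [_ [[n Nn Gn] _]]; have [p _ Dp] := d2 _ _ Nn.
  by exists p => //; exists n.
- move=> L m [_ [_ [n Nn Gn]]]; have [p _ Dp] := d2' _ _ Nn.
  by exists p => //; exists n.
- move=> L m p p' [M1m [[n0 N2n0 Gn0] [n0' N2n0' Gn0']]] [n Gn Dp] [n' Gn' Dp'].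
  have [p0 _ Dp0] := d2 _ _ N2n0; have [p0' _ Dp0'] := d2' _ _ N2n0'.
  have [q _ Dq] := d2 _ _ N2n0'.
  have h1 : I1 L (p - p0).
    exists (n - n0); last exact: (lrB Dp Dp0).
    by apply/lr_indE; rewrite -(subrr m); exact: lrB.
  have h2 : I2 L (p0' - p').
    exists (n0' - n'); last exact: (lrB Dp0' Dp').
    by apply/lr_indE; rewrite -(subrr m); exact: lrB.
  have h3 : I3 L (p0 - q).
    by exists (n0 - n0'); [exact: e1 M1m Gn0 Gn0'|exact: (lrB Dp0 Dq)].
  have h4 : P2 L (q - p0') by exact: e2 N2n0' Dq Dp0'.
  have -> : p - p' = ((p - p0) + (p0' - p')) + ((p0 - q) + (q - p0')).
    rewrite [(p0 - q) + _]addrA subrK addrACA [p0' - p' + _]addrC.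
    by rewrite addrA subrK addrA subrK.
  by apply: smD; [apply: sm_addl|apply: sm_addr]; apply: smD;
    do [exact: sm_addl|exact: sm_addr].
Qed.

Program Definition ModK : category :=
  @Category {M : FImod | finitely_generated M}
    (fun M N => Kmor (sval M) (sval N)) (fun M N => @Kmor_eq _ _)
    (fun M => Kmor_of (FIhom_id (sval M))) (fun M N P D G => Kmor_comp D G)
    _ _ _ _ _ _ _.
Next Obligation. by move=> *; exact: Kmor_eq_refl. Qed.
Next Obligation. by move=> M N G G'; exact: Kmor_eq_sym. Qed.
Next Obligation. by move=> M N G1 G2 G3; exact: Kmor_eq_trans. Qed.
Next Obligation. by move=> M N P D D' G G'; exact: Kmor_comp_eq. Qed.
Next Obligation.
move=> M N P Q E D G; apply: Kmor_eq_ext => L m q; split.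
  by move=> [p [n Gn Dp] Eq]; exists n => //; exists p.
by move=> [n Gn [p Dp Eq]]; exists p => //; exists n.
Qed.
Next Obligation.
move=> M N G; apply: Kmor_eq_ext => L m n; split.
  by move=> [n' Gn ->].
by move=> Gn; exists n.
Qed.
Next Obligation.
move=> M N G; apply: Kmor_eq_ext => L m n; split.
  by move=> [m' -> Gn].
by move=> Gn; exists m.
Qed.

Program Definition Tq : functor ModA_fg ModK :=
  @Functor ModA_fg ModK (fun M => M) (fun M N f => Kmor_of f) _ _ _.
Next Obligation.
by move=> M N f g fg; apply: Kmor_eq_ext => L m n /=; rewrite fg.
Qed.
Next Obligation. by move=> M; exact: Kmor_eq_refl. Qed.
Next Obligation.
move=> M N P g f; apply: Kmor_eq_ext => L m p; split.
  by move=> /= ->; exists (f L m).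
by move=> [n /= -> ->].
Qed.

(** The countable set $\mathcal B$ is [nat]. *)
Record fperm := FPerm {
  pfun :> nat -> nat;
  pinv : nat -> nat;
  pfunK : cancel pfun pinv;
  pinvK : cancel pinv pfun;
  pfun_fin : exists s : seq nat, forall i, i \notin s -> pfun i = i }.

Program Definition fperm_id : fperm := @FPerm id id _ _ _.
Next Obligation. by []. Qed.
Next Obligation. by []. Qed.
Next Obligation. by exists [::]. Qed.

Program Definition fperm_comp (s t : fperm) : fperm :=
  @FPerm (s \o t) (pinv t \o pinv s) _ _ _.
Next Obligation. by move=> s t i /=; rewrite !pfunK. Qed.
Next Obligation. by move=> s t i /=; rewrite !pinvK. Qed.
Next Obligation.
move=> s t; have [S hS] := pfun_fin s; have [T' hT] := pfun_fin t.
exists (S ++ T') => i; rewrite mem_cat negb_or => /andP[iS iT] /=.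
by rewrite hT // hS.
Qed.

Definition fperm_inj (s : fperm) : inj nat nat := Inj (can_inj (pfunK s)).

Record rep := MkRep {
  rsp :> lmodType k;
  ract : fperm -> {linear rsp -> rsp};
  ract_id : forall v, ract fperm_id v = v;
  ract_comp : forall s t v, ract (fperm_comp s t) v = ract s (ract t v) }.

Arguments ract _ _ : clear implicits.

Record rhom (V W : rep) := RHom {
  rh :> {linear V -> W};
  rh_equiv : forall s v, rh (ract V s v) = ract W s (rh v) }.

Program Definition rhom_id (V : rep) : rhom V V := @RHom V V idfun _.
Next Obligation. by []. Qed.

Program Definition rhom_comp (U V W : rep) (g : rhom V W) (f : rhom U V) :
  rhom U W := @RHom U W (g \o f) _.
Next Obligation. by move=> U V W g f s v /=; rewrite !rh_equiv. Qed.

Program Definition Rep_all : category :=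
  @Category rep rhom (fun V W f g => f =1 g) rhom_id rhom_comp _ _ _ _ _ _ _.
Next Obligation. by []. Qed.
Next Obligation. by move=> V W f g fg v; rewrite fg. Qed.
Next Obligation. by move=> V W f g h fg gh v; rewrite fg gh. Qed.
Next Obligation. by move=> U V W g g' f f' gg ff v /=; rewrite ff gg. Qed.
Next Obligation. by []. Qed.
Next Obligation. by []. Qed.
Next Obligation. by []. Qed.

(** $\bigoplus_{j<r} \mathbf V^{\otimes n_j}$ is the free vector space on the
    symbols $(j, e_{i_1} \otimes \dots \otimes e_{i_{n_j}})$, which are permuted
    by the group. *)
Section TensorPowers.
Variables (r : nat) (n : 'I_r -> nat).

Definition tbasis : choiceType := {j : 'I_r & (n j).-tuple nat}.

Definition tbasis_act (s : fperm) (b : tbasis) : tbasis :=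
  Tagged (fun j => (n j).-tuple nat) (map_tuple s (tagged b)).

Definition tsum_act (s : fperm) : {freeg tbasis / k} -> {freeg tbasis / k} :=
  fglift (fun b => << tbasis_act s b >>).

Let tsum_actU s c b : tsum_act s << c *g b >> = << c *g tbasis_act s b >>.
Proof.
rewrite /tsum_act liftU; apply/eqP/freeg_eqP => x.
by rewrite coeffZ !coeffU mul1r.
Qed.

HB.instance Definition _ s := GRing.isZmodMorphism.Build
  {freeg tbasis / k} {freeg tbasis / k} (tsum_act s)
  (lift_is_additive (fun b => << tbasis_act s b >>)).

Let tsum_actD s : {morph tsum_act s : x y / x + y}.
Proof. exact: raddfD. Qed.

Let tsum_act_sum s I (e : seq I) (F : I -> {freeg tbasis / k}) :
  tsum_act s (\sum_(i <- e) F i) = \sum_(i <- e) tsum_act s (F i).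
Proof. exact: raddf_sum. Qed.

Fact tsum_act_linear s : linear (tsum_act s).
Proof.
move=> a x y; rewrite tsum_actD; congr (_ + _).
rewrite -[x]freeg_sumE scaler_sumr !tsum_act_sum scaler_sumr.
apply: eq_bigr => b _; rewrite tsum_actU.
have scaleU c (b' : tbasis) : a *: << c *g b' >> = << a * c *g b' >> :> {freeg tbasis / k}.
  by apply/eqP/freeg_eqP => z; rewrite coeffZ !coeffU mulrA.
by rewrite !scaleU tsum_actU.
Qed.

Fact tsum_act_id x : tsum_act fperm_id x = x.
Proof.
rewrite -[x]freeg_sumE tsum_act_sum; apply: eq_bigr => -[j t] _.
rewrite tsum_actU; congr << _ *g Tagged _ _ >>.
by apply: val_inj; rewrite /= map_id.
Qed.

Fact tsum_act_comp s t x :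
  tsum_act (fperm_comp s t) x = tsum_act s (tsum_act t x).
Proof.
rewrite -[x]freeg_sumE !tsum_act_sum; apply: eq_bigr => -[j u] _.
rewrite !tsum_actU; congr << _ *g Tagged _ _ >>.
by apply: val_inj; rewrite /= map_comp.
Qed.

Definition tsum : rep :=
  @MkRep {freeg tbasis / k} (fun s => mk_linear (tsum_act_linear s))
    tsum_act_id tsum_act_comp.

End TensorPowers.

(** [V] is a quotient (by [q]) of a subrepresentation (the image of [i]). *)
Definition algebraic (V : rep) : Prop :=
  exists (r : nat) (n : 'I_r -> nat) (X : rep)
    (i : rhom X (tsum n)) (q : rhom X V),
    injective i /\ (forall v, exists x, q x = v).

Definition Rep : category := @full_sub Rep_all algebraic.

Definition incl (A B : {fset nat}) (AB : (A `<=` B)%fset) : inj A B :=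
  Inj (@fincl_inj _ _ _ AB).

Definition perm_fset (s : fperm) (L : {fset nat}) : {fset nat} :=
  [fset s x | x in L]%fset.

Definition perm_res_fun (s : fperm) (L : {fset nat}) (x : L) : perm_fset s L :=
  [` in_imfset imfset_key s (valP x)]%fset.

Fact perm_res_inj s L : injective (@perm_res_fun s L).
Proof.
move=> x y /(congr1 val) /= xy; apply: val_inj.
exact: can_inj (pfunK s) _ _ xy.
Qed.

Definition perm_res (s : fperm) (L : {fset nat}) : inj L (perm_fset s L) :=
  Inj (@perm_res_inj s L).

Lemma fi_map_eq (M : FImod) (L L' : finType) (f g : inj L L') (x : M L) :
  f =1 g -> fi_map M f x = fi_map M g x.
Proof. by move=> /inj_ext ->. Qed.

Section Colimit.
Variable M : FImod.

Definition cpre := {L : {fset nat} & M L}.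

Definition cpre_eq (x y : cpre) : Prop :=
  exists (L : {fset nat}) (hx : (tag x `<=` L)%fset) (hy : (tag y `<=` L)%fset),
    fi_map M (incl hx) (tagged x) = fi_map M (incl hy) (tagged y).

Lemma inclK (A B C : {fset nat}) (AB : (A `<=` B)%fset) (BC : (B `<=` C)%fset)
    (sAC : (A `<=` C)%fset) (x : M A) :
  fi_map M (incl BC) (fi_map M (incl AB) x) = fi_map M (incl sAC) x.
Proof. by rewrite -fi_map_comp; apply: fi_map_eq => i; exact: val_inj. Qed.

Lemma cpre_eq_refl x : cpre_eq x x.
Proof. by exists (tag x), (fsubset_refl _), (fsubset_refl _). Qed.

Lemma cpre_eq_sym x y : cpre_eq x y -> cpre_eq y x.
Proof. by move=> [L [hx [hy e]]]; exists L, hy, hx. Qed.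

Lemma cpre_eq_trans x y z : cpre_eq x y -> cpre_eq y z -> cpre_eq x z.
Proof.
move=> [L [hx [hy e]]] [L' [hy' [hz e']]].
have hL := fsubsetUl L L'; have hL' := fsubsetUr L L'.
exists (L `|` L')%fset, (fsubset_trans hx hL), (fsubset_trans hz hL').
rewrite -(inclK hx hL) e -(inclK hz hL') -e'.
by rewrite !(inclK _ _ (fsubset_trans hy hL)).
Qed.

Definition cpre_rel : rel cpre := fun x y => `[< cpre_eq x y >].

Fact cpre_rel_refl : reflexive cpre_rel.
Proof. by move=> x; apply/asboolP; exact: cpre_eq_refl. Qed.

Fact cpre_rel_sym : symmetric cpre_rel.
Proof. by move=> x y; apply/asbool_equiv_eq; split; exact: cpre_eq_sym. Qed.

Fact cpre_rel_trans : transitive cpre_rel.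
Proof.
move=> y x z /asboolP xy /asboolP yz; apply/asboolP; exact: cpre_eq_trans yz.
Qed.

Canonical cpre_equiv := EquivRel cpre_rel cpre_rel_refl cpre_rel_sym cpre_rel_trans.

(** $T'(M)$: the filtered colimit of the [M L], as pairs [(L, x)] up to [cpre_eq]. *)
Definition colim := {eq_quot cpre_equiv}.
HB.instance Definition _ := Choice.on colim.

Definition cin (L : {fset nat}) (x : M L) : colim :=
  \pi_{eq_quot cpre_equiv} (Tagged (fun L : {fset nat} => M L) x).

Lemma cin_eq (L L' : {fset nat}) (x : M L) (y : M L') :
  cin x = cin y <->
  exists (L'' : {fset nat}) (hx : (L `<=` L'')%fset) (hy : (L' `<=` L'')%fset),
    fi_map M (incl hx) x = fi_map M (incl hy) y.
Proof.
split; first by move=> /eqmodP /asboolP.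
by move=> h; apply/eqmodP/asboolP.
Qed.

Lemma cin_map (L L' : {fset nat}) (h : (L `<=` L')%fset) (x : M L) :
  cin (fi_map M (incl h) x) = cin x.
Proof.
apply/cin_eq; exists L', (fsubset_refl _), h.
by rewrite (inclK _ _ h).
Qed.

Lemma cin_tagged (z : colim) : cin (tagged (repr z)) = z.
Proof. by rewrite -[RHS]reprK /cin; case: (repr z). Qed.

Lemma cinP (z : colim) : exists (L : {fset nat}) (x : M L), z = cin x.
Proof. by exists (projT1 (repr z)), (tagged (repr z)); rewrite cin_tagged. Qed.

Lemma cinP2 (z z' : colim) :
  exists (L : {fset nat}) (x x' : M L), z = cin x /\ z' = cin x'.
Proof.
have [L [x ->]] := cinP z; have [L' [x' ->]] := cinP z'.
exists (L `|` L')%fset, (fi_map M (incl (fsubsetUl L L')) x).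
by exists (fi_map M (incl (fsubsetUr L L')) x'); rewrite !cin_map.
Qed.

Definition cadd (z z' : colim) : colim :=
  cin (fi_map M (incl (fsubsetUl (tag (repr z)) (tag (repr z')))) (tagged (repr z)) +
       fi_map M (incl (fsubsetUr (tag (repr z)) (tag (repr z')))) (tagged (repr z'))).

Definition copp (z : colim) : colim := cin (- tagged (repr z)).

Definition cscale (a : k) (z : colim) : colim := cin (a *: tagged (repr z)).

Lemma cin_repr (L : {fset nat}) (x : M L) :
  cin (tagged (repr (cin x))) = cin x.
Proof. exact: cin_tagged. Qed.

Lemma cin_lift (L : {fset nat}) (x y : M L) : cin x = cin y ->
  exists (L' : {fset nat}) (h : (L `<=` L')%fset),
    fi_map M (incl h) x = fi_map M (incl h) y.
Proof.
move/cin_eq => [L' [h [h' e]]]; exists L', h.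
by rewrite e (bool_irrelevance h h').
Qed.

Lemma cadd_cin (L : {fset nat}) (x y : M L) : cadd (cin x) (cin y) = cin (x + y).
Proof.
rewrite /cadd; move: (cin_repr x) (cin_repr y).
move: (repr (cin x)) (repr (cin y)) => [A a] [B b] /=.
move=> /cin_eq[C [sAC [LC e]]] /cin_eq[D [BD [LD e']]].
set E := (C `|` D)%fset.
have CE : (C `<=` E)%fset := fsubsetUl C D.
have DE : (D `<=` E)%fset := fsubsetUr C D.
have ABE : (A `|` B `<=` E)%fset.
  by rewrite fsubUset (fsubset_trans sAC) // (fsubset_trans BD).
apply/cin_eq; exists E, ABE, (fsubset_trans LC CE); rewrite !linearD.
rewrite (inclK _ _ (fsubset_trans sAC CE)) (inclK _ _ (fsubset_trans BD DE)).
rewrite -(inclK sAC CE) e (inclK _ _ (fsubset_trans LC CE)).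
rewrite -(inclK BD DE) e' (inclK _ _ (fsubset_trans LD DE)).
by rewrite (bool_irrelevance (fsubset_trans LD DE) (fsubset_trans LC CE)).
Qed.

Lemma copp_cin (L : {fset nat}) (x : M L) : copp (cin x) = cin (- x).
Proof.
rewrite /copp; move: (cin_repr x); case: (repr (cin x)) => A a /= /cin_eq.
move=> [C [sAC [LC e]]]; apply/cin_eq; exists C, sAC, LC; rewrite !raddfN.
by congr (- _).
Qed.

Lemma cscale_cin a (L : {fset nat}) (x : M L) : cscale a (cin x) = cin (a *: x).
Proof.
rewrite /cscale; move: (cin_repr x); case: (repr (cin x)) => A b /= /cin_eq.
by move=> [C [sAC [LC e]]]; apply/cin_eq; exists C, sAC, LC; rewrite !linearZ e.
Qed.

Definition czero : colim := cin (0 : M (fset0 : {fset nat})).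

Lemma cin0 (L : {fset nat}) : cin (0 : M L) = czero.
Proof. by rewrite /czero -(cin_map (fsub0set L)) linear0. Qed.

Fact caddA : associative cadd.
Proof.
move=> x y z; have [L [a [b [-> ->]]]] := cinP2 x y; have [L' [c ->]] := cinP z.
have hL := fsubsetUl L L'; have hL' := fsubsetUr L L'.
rewrite -(cin_map hL a) -(cin_map hL b) -(cin_map hL' c).
by rewrite !cadd_cin addrA.
Qed.

Fact caddC : commutative cadd.
Proof.
by move=> x y; have [L [a [b [-> ->]]]] := cinP2 x y; rewrite !cadd_cin addrC.
Qed.

Fact cadd0 : left_id czero cadd.
Proof.
by move=> x; have [L [a ->]] := cinP x; rewrite -(cin0 L) cadd_cin add0r.
Qed.

Fact caddN : left_inverse czero copp cadd.
Proof.
by move=> x; have [L [a ->]] := cinP x; rewrite copp_cin cadd_cin addNr cin0.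
Qed.

HB.instance Definition _ := GRing.isZmodule.Build colim caddA caddC cadd0 caddN.

Lemma cinD (L : {fset nat}) (x y : M L) : cin (x + y) = cin x + cin y.
Proof. by rewrite -cadd_cin. Qed.

Lemma cinB (L : {fset nat}) (x y : M L) : cin (x - y) = cin x - cin y.
Proof. by rewrite cinD -copp_cin. Qed.

Fact cscaleA a b x : cscale a (cscale b x) = cscale (a * b) x.
Proof. by have [L [y ->]] := cinP x; rewrite !cscale_cin scalerA. Qed.

Fact cscale1 : left_id 1 cscale.
Proof. by move=> x; have [L [y ->]] := cinP x; rewrite cscale_cin scale1r. Qed.

Fact cscaleDr : right_distributive cscale +%R.
Proof.
move=> a x y; have [L [u [v [-> ->]]]] := cinP2 x y.
by rewrite -cinD !cscale_cin scalerDr cinD.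
Qed.

Fact cscaleDl x : {morph cscale^~ x : a b / a + b}.
Proof.
by move=> a b; have [L [y ->]] := cinP x; rewrite !cscale_cin scalerDl cinD.
Qed.

HB.instance Definition _ :=
  GRing.Zmodule_isLmodule.Build k colim cscaleA cscale1 cscaleDr cscaleDl.

Lemma cinZ a (L : {fset nat}) (x : M L) : cin (a *: x) = a *: cin x.
Proof. by rewrite -cscale_cin. Qed.

Definition cact (s : fperm) (z : colim) : colim :=
  cin (fi_map M (perm_res s (tag (repr z))) (tagged (repr z))).

Lemma cact_cin s (L : {fset nat}) (x : M L) :
  cact s (cin x) = cin (fi_map M (perm_res s L) x).
Proof.
rewrite /cact; move: (cin_repr x); case: (repr (cin x)) => A a /= /cin_eq.
move=> [C [sAC [LC e]]].
have sub_perm (X : {fset nat}) : (X `<=` C)%fset ->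
    (perm_fset s X `<=` perm_fset s C)%fset.
  by move=> XC; apply/fsubsetP => _ /imfsetP[i iX ->]; apply: in_imfset; exact: (fsubsetP XC).
apply/cin_eq; exists (perm_fset s C), (sub_perm _ sAC), (sub_perm _ LC).
have nat_res (X : {fset nat}) (XC : (X `<=` C)%fset) (y : M X) :
    fi_map M (incl (sub_perm _ XC)) (fi_map M (perm_res s X) y) =
    fi_map M (perm_res s C) (fi_map M (incl XC) y).
  by rewrite -!fi_map_comp; apply: fi_map_eq => i; exact: val_inj.
by rewrite !nat_res e.
Qed.

Fact cact_linear s : linear (cact s).
Proof.
move=> a x y; have [L [u [v [-> ->]]]] := cinP2 x y.
by rewrite -cinZ -cinD !cact_cin linearP cinD cinZ.
Qed.

Fact cact_id z : cact fperm_id z = z.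
Proof.
have [L [x ->]] := cinP z; rewrite cact_cin.
have h : (L `<=` perm_fset fperm_id L)%fset.
  by apply/fsubsetP => i iL; apply/imfsetP; exists i.
by rewrite -(cin_map h x); congr cin; apply: fi_map_eq => i; exact: val_inj.
Qed.

Fact cact_comp s t z : cact (fperm_comp s t) z = cact s (cact t z).
Proof.
have [L [x ->]] := cinP z; rewrite !cact_cin -fi_map_comp.
have h : (perm_fset (fperm_comp s t) L `<=` perm_fset s (perm_fset t L))%fset.
  apply/fsubsetP => _ /imfsetP[i iL ->].
  by apply: in_imfset; exact: in_imfset.
rewrite -(cin_map h) -fi_map_comp; congr cin.
by apply: fi_map_eq => i; exact: val_inj.
Qed.

Definition Tprime_ob : rep :=
  @MkRep colim (fun s => mk_linear (cact_linear s)) cact_id cact_comp.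

End Colimit.

Section ColimitMap.
Variables (M N : FImod) (f : FIhom M N).

Definition cmap (z : colim M) : colim N := cin (f (tag (repr z)) (tagged (repr z))).

Lemma cmap_cin (L : {fset nat}) (x : M L) : cmap (cin x) = cin (f L x).
Proof.
rewrite /cmap; move: (cin_repr x); case: (repr (cin x)) => A a /= /cin_eq.
move=> [C [sAC [LC e]]]; apply/cin_eq; exists C, sAC, LC.
by rewrite -!fih_nat e.
Qed.

Fact cmap_linear : linear cmap.
Proof.
move=> a x y; have [L [u [v [-> ->]]]] := cinP2 x y.
by rewrite -cinZ -cinD !cmap_cin linearP cinD cinZ.
Qed.

Fact cmap_equiv s z : cmap (cact s z) = cact s (cmap z).
Proof.
by have [L [x ->]] := cinP z; rewrite cact_cin !cmap_cin cact_cin fih_nat.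
Qed.

Definition Tprime_mor : rhom (Tprime_ob M) (Tprime_ob N) :=
  @RHom (Tprime_ob M) (Tprime_ob N) (mk_linear cmap_linear) cmap_equiv.

End ColimitMap.

Program Definition Tprime : functor ModA Rep_all :=
  @Functor ModA Rep_all Tprime_ob Tprime_mor _ _ _.
Next Obligation.
by move=> M N f g fg z; have [L [x ->]] := cinP z; rewrite /= !cmap_cin fg.
Qed.
Next Obligation.
by move=> M z; have [L [x ->]] := cinP z; rewrite /= cmap_cin.
Qed.
Next Obligation.
by move=> M N P g f z; have [L [x ->]] := cinP z; rewrite /= !cmap_cin.
Qed.

Section Invariants.
Variable V : rep.

Section Families.
Variable L : finType.

Definition inv_family (m : inj L nat -> V) : Prop :=
  (forall (i : inj L nat) (s : fperm),
     (forall x : L, s (i x) = i x) -> ract V s (m i) = m i) /\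
  (forall (i : inj L nat) (s : fperm),
     m (fi_comp (fperm_inj s) i) = ract V s (m i)).

Definition inv_family_pred : {pred (inj L nat -> V)} :=
  fun m => `[< inv_family m >].

Fact inv_family_closed : subsemimod_closed inv_family_pred.
Proof.
split; first split.
- by apply/asboolP; split=> *; rewrite linear0.
- move=> u v /asboolP[u1 u2] /asboolP[v1 v2]; apply/asboolP; split=> i s.
    by move=> h; rewrite linearD u1 // v1.
  by rewrite linearD -u2 -v2.
- move=> a u /asboolP[u1 u2]; apply/asboolP; split=> i s.
    by move=> h; rewrite linearZ u1.
  by rewrite linearZ -u2.
Qed.

Record inv_space := InvSpace {
  inv_fun :> inj L nat -> V;
  inv_funP : inv_fun \in inv_family_pred }.

HB.instance Definition _ := [isSub for inv_fun].
HB.instance Definition _ := [Choice of inv_space by <:].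
HB.instance Definition _ := GRing.SubChoice_isSubLmodule.Build k
  (inj L nat -> V) inv_family_pred inv_space inv_family_closed.

End Families.

Fact inv_push_subproof (L L' : finType) (f : inj L L') (m : inv_space L) :
  (fun i : inj L' nat => m (fi_comp i f)) \in @inv_family_pred L'.
Proof.
have /asboolP[m1 m2] := inv_funP m; apply/asboolP; split=> i s.
  by move=> h; apply: m1 => x; exact: h.
by rewrite -m2; congr (inv_fun m _); exact: inj_ext.
Qed.

Definition inv_push (L L' : finType) (f : inj L L') (m : inv_space L) :
  inv_space L' := InvSpace (inv_push_subproof f m).

Fact inv_push_linear (L L' : finType) (f : inj L L') : linear (inv_push f).
Proof. by move=> a x y; apply: val_inj. Qed.

Fact inv_push_id (L : finType) (m : inv_space L) : inv_push (fi_id L) m = m.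
Proof.
apply: val_inj; apply/funext => i /=.
by congr (inv_fun m _); exact: inj_ext.
Qed.

Fact inv_push_comp (L L' L'' : finType) (g : inj L' L'') (f : inj L L')
  (m : inv_space L) : inv_push (fi_comp g f) m = inv_push g (inv_push f m).
Proof.
apply: val_inj; apply/funext => i /=.
by congr (inv_fun m _); exact: inj_ext.
Qed.

Definition Sprime_ob : FImod :=
  @FIMod (fun L => inv_space L : lmodType k)
    (fun L L' f => mk_linear (@inv_push_linear L L' f)) inv_push_id inv_push_comp.

End Invariants.

Section InvariantsMap.
Variables (V W : rep) (f : rhom V W).

Fact inv_map_subproof (L : finType) (m : inv_space V L) :
  (fun i => f (m i)) \in @inv_family_pred W L.
Proof.
have /asboolP[m1 m2] := inv_funP m; apply/asboolP; split=> i s.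
  by move=> h; rewrite -rh_equiv m1.
by rewrite -rh_equiv m2.
Qed.

Definition inv_map (L : finType) (m : inv_space V L) : inv_space W L :=
  InvSpace (inv_map_subproof m).

Fact inv_map_linear L : linear (@inv_map L).
Proof. by move=> a x y; apply: val_inj; apply/funext => i; rewrite /= linearP. Qed.

Fact inv_map_nat (L L' : finType) (g : inj L L') (m : inv_space V L) :
  inv_map (inv_push g m) = inv_push g (inv_map m).
Proof. exact: val_inj. Qed.

Definition Sprime_mor : FIhom (Sprime_ob V) (Sprime_ob W) :=
  @FIHom (Sprime_ob V) (Sprime_ob W) (fun L => mk_linear (@inv_map_linear L))
    inv_map_nat.

End InvariantsMap.

Program Definition Sprime : functor Rep_all ModA :=
  @Functor Rep_all ModA Sprime_ob Sprime_mor _ _ _.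
Next Obligation.
move=> V W f g fg L m; apply: val_inj; apply/funext => i; exact: fg.
Qed.
Next Obligation. by move=> V L m; exact: val_inj. Qed.
Next Obligation. by move=> U V W g f L m; exact: val_inj. Qed.

Lemma finite_length_large M (A B : submod M) : finite_length A B ->
  exists d, forall L : finType, (d <= #|L|)%N -> forall x, B L x -> A L x.
Proof.
elim=> {A B}[A B _ BA|A B C _ [d hd] [BC CB simp]].
  by exists 0%N => L _; exact: BA.
have [L0 [x0 [Cx0 nBx0]]] : exists (L : finType) (x : M L), C L x /\ ~ B L x.
  apply: contrapT => h; apply: CB => L x Cx; apply: contrapT => nBx.
  by apply: h; exists L, x.
pose d0 := #|L0|.
pose P (L : finType) (x : M L) := C L x /\ (B L x \/ (d0 < #|L|)%N).
have P0 L : P L 0 by split; [exact: sm0|left; exact: sm0].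
have PD L x y : P L x -> P L y -> P L (x + y).
  by move=> [? [?|?]] [? [?|?]]; split; do ?[exact: smD]; do ?[by right];
    left; exact: smD.
have PZ L a x : P L x -> P L (a *: x).
  by move=> [? [?|?]]; split; do ?[exact: smZ]; [left; exact: smZ|right].
have Pm (L L' : finType) (f : inj L L') x : P L x -> P L' (fi_map M f x).
  move=> [? [?|h]]; (split; first exact: sm_map); [left; exact: sm_map|right].
  exact: leq_trans h (leq_card f (@inj_inj _ _ f)).
pose D := @Submod M P P0 PD PZ Pm.
have [||DB|CD] := simp D.
- by move=> L x Bx; split; [exact: BC|left].
- by move=> L x [].
- exists (maxn d d0.+1) => L; rewrite geq_max => /andP[dL d0L] x Cx.
  by apply: hd => //; apply: DB; split=> //; right.
- by have [_ [//|]] := CD _ _ Cx0; rewrite ltnn.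
Qed.

Lemma large_fset (L : {fset nat}) (d : nat) :
  exists2 L' : {fset nat}, (L `<=` L')%fset & (d <= #|{: L'}|)%N.
Proof.
pose I : {fset nat} := [fset i in iota 0 d]%fset.
exists (L `|` I)%fset; first exact: fsubsetUl.
rewrite -cardfE; apply: leq_trans (fsubset_leq_card (fsubsetUr L I)).
rewrite card_fseq undup_id ?iota_uniq ?size_iota //.
Qed.

Lemma finite_length_cin M (A : submod M) (L : {fset nat}) (x : M L) :
  finite_length A (sm_full M) ->
  exists (L' : {fset nat}) (h : (L `<=` L')%fset), A L' (fi_map M (incl h) x).
Proof.
move=> /finite_length_large[d hd]; have [L' h dL'] := large_fset L d.
by exists L', h; exact: hd.
Qed.

Lemma finite_length_cin0 M (A : submod M) (L : {fset nat}) (x : M L) :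
  finite_length (sm_zero M) A -> A L x -> cin x = 0.
Proof.
move=> /finite_length_large[d hd] Ax; have [L' h dL'] := large_fset L d.
rewrite -(cin_map h); have -> : fi_map M (incl h) x = 0.
  by apply: hd => //; exact: sm_map.
exact: cin0.
Qed.

Section PhiMor.
Variables (M N : FImod) (G : Kmor M N).

(** Since $T'$ inverts $M' \subset M$ and $N \to N/N'$, a representative
    $f \colon M' \to N/N'$ induces a map $T'(M) \to T'(N)$, whose graph is: *)
Definition Phi_graph (x : colim M) (y : colim N) : Prop :=
  exists (L : {fset nat}) (m : M L) (n : N L), [/\ G L m n, x = cin m & y = cin n].

Lemma Phi_graph_total x : exists y, Phi_graph x y.
Proof.
have [L [m ->]] := cinP x.
have [L' [h [n _ Gn]]] := finite_length_cin m (krel_dom G).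
by exists (cin n), L', (fi_map M (incl h) m), n; rewrite cin_map.
Qed.

Lemma Phi_graph_fun x y y' : Phi_graph x y -> Phi_graph x y' -> y = y'.
Proof.
move=> [L [m [n [Gn -> ->]]]] [L' [m' [n' [Gn' /cin_eq mm' ->]]]].
have [L'' [h [h' e]]] := mm'.
rewrite -(cin_map h n) -(cin_map h' n').
have : cin (fi_map N (incl h) n - fi_map N (incl h') n') = 0.
  apply: finite_length_cin0 (krel_ind G) _; apply/lr_indE.
  rewrite -(subrr (fi_map M (incl h) m)) {2}e.
  by apply: lrB; exact: lr_map.
by rewrite cinB => /eqP; rewrite subr_eq0 => /eqP.
Qed.

Definition Phi_fun (x : colim M) : colim N := projT1 (cid (Phi_graph_total x)).

Lemma Phi_funP x y : Phi_fun x = y <-> Phi_graph x y.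
Proof.
have h := projT2 (cid (Phi_graph_total x)).
by split=> [<- //|]; exact: Phi_graph_fun.
Qed.

Fact Phi_fun_linear : linear Phi_fun.
Proof.
move=> a x x'; apply/Phi_funP.
have /Phi_funP[L [m [n [Gn -> ->]]]] := erefl (Phi_fun x).
have /Phi_funP[L' [m' [n' [Gn' -> ->]]]] := erefl (Phi_fun x').
have hL := fsubsetUl L L'; have hL' := fsubsetUr L L'.
exists (L `|` L')%fset, (a *: fi_map M (incl hL) m + fi_map M (incl hL') m').
exists (a *: fi_map N (incl hL) n + fi_map N (incl hL') n').
split; first by apply: lrD; [apply: lrZ|]; exact: lr_map.
  by rewrite cinD cinZ !cin_map.
by rewrite cinD cinZ !cin_map.
Qed.

Fact Phi_fun_equiv s x : Phi_fun (cact s x) = cact s (Phi_fun x).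
Proof.
apply/Phi_funP; have /Phi_funP[L [m [n [Gn -> ->]]]] := erefl (Phi_fun x).
exists (perm_fset s L), (fi_map M (perm_res s L) m), (fi_map N (perm_res s L) n).
by split; [exact: lr_map|exact: cact_cin|exact: cact_cin].
Qed.

Definition Phi_mor : rhom (Tprime_ob M) (Tprime_ob N) :=
  @RHom (Tprime_ob M) (Tprime_ob N) (mk_linear Phi_fun_linear) Phi_fun_equiv.

End PhiMor.

Lemma Phi_mor_eq M N (G G' : Kmor M N) :
  Kmor_eq G G' -> Phi_mor G =1 Phi_mor G'.
Proof.
move=> [M' [N' [fM fN d d' e]]] x; have [L0 [m0 ->]] := cinP x.
have [L [h M'm]] := finite_length_cin m0 fM; rewrite -(cin_map h) /=.
move: (fi_map M (incl h) m0) M'm => m M'm.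
have [n _ Gn] := d _ _ M'm; have [n' _ Gn'] := d' _ _ M'm.
have -> : Phi_fun G (cin m) = cin n by apply/Phi_funP; exists L, m, n.
have -> : Phi_fun G' (cin m) = cin n' by apply/Phi_funP; exists L, m, n'.
have : cin (n - n') = 0 by apply: finite_length_cin0 fN _; exact: e Gn Gn'.
by rewrite cinB => /eqP; rewrite subr_eq0 => /eqP.
Qed.

Lemma Phi_mor_of M N (f : FIhom M N) : Phi_mor (Kmor_of f) =1 Tprime_mor f.
Proof.
move=> x; have [L [m ->]] := cinP x; rewrite /= cmap_cin.
by apply/Phi_funP; exists L, m, (f L m).
Qed.

Lemma Phi_mor_comp M N P (D : Kmor N P) (G : Kmor M N) :
  Phi_mor (Kmor_comp D G) =1 Phi_mor D \o Phi_mor G.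
Proof.
move=> x /=; apply/Phi_funP.
have [L0 [m0 ->]] := cinP x.
have [L [h [p _ [n Gn Dp]]]] :=
  finite_length_cin m0 (krel_dom (Kmor_comp D G)).
rewrite -(cin_map h); move: (fi_map M (incl h) m0) Gn => m Gn.
have -> : Phi_fun G (cin m) = cin n by apply/Phi_funP; exists L, m, n.
have -> : Phi_fun D (cin n) = cin p by apply/Phi_funP; exists L, n, p.
by exists L, m, p; split=> //; exists n.
Qed.

Section PhiPsi.

Variable hT : forall M : FImod, finitely_generated M -> algebraic (Tprime_ob M).
Variable hS : forall V : rep, algebraic V -> finitely_generated (Sprime_ob V).

Definition Tprime_fg : functor ModA_fg Rep :=
  @functor_restrict ModA Rep_all finitely_generated algebraic Tprime hT.

Definition Sprime_fg : functor Rep ModA_fg :=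
  @functor_restrict Rep_all ModA algebraic finitely_generated Sprime hS.

Program Definition Phi : functor ModK Rep :=
  @Functor ModK Rep
    (fun M => exist algebraic (Tprime_ob (sval M)) (hT (svalP M)))
    (fun M N G => Phi_mor G) _ _ _.
Next Obligation. by move=> M N G G'; exact: Phi_mor_eq. Qed.
Next Obligation.
move=> M x; rewrite [LHS]Phi_mor_of; exact: (fmor_id Tprime).
Qed.
Next Obligation. by move=> M N P D G; exact: Phi_mor_comp. Qed.

(** $\Phi T = T'$; the two sides have the same values on objects. *)
Lemma Phi_Tq (M N : ModA_fg) (f : hom M N) :
  heq (fmor Phi (fmor Tq f)) (fmor Tprime_fg f).
Proof. exact: Phi_mor_of. Qed.

Definition Psi : functor Rep ModK := functor_comp Tq Sprime_fg.

End PhiPsi.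

End Main.

Arguments fi_map {k} _ {L L'} _.
Arguments ract {k} _ _.

(* Main.v *)
From HB Require Import structures.
Require Import Defs.
From mathcomp Require Import all_boot all_algebra reals complex.
From mathcomp Require Import perm finmap boolp freeg.

(** Everything rests on the noetherianity of finitely generated modules over
    finite sets and injections, which is proved here over an arbitrary field by
    the argument of Church, Ellenberg, Farb and Nagpal: let [W] be a submodule of
    the module generated by one element [x] of degree [D].  After shifting by a
    large finite set [E], the elements of [W] have a leading part, made of the
    translates of [x] that avoid [E]; the leading parts are generated in degree
    [D] and stop growing with [E], whereas the translates of [x] that hit [E]
    generate a module in degrees smaller than [D], to which induction applies.

    Hence torsion in $\Sigma G/G$ vanishes in large degrees, where $\Sigma$ is the
    shift by one point and $G \subset S'(V)$ is finitely generated.  When every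
    vector of $V$ occurs as a member of a family in $G$, this forces
    $G_L = S'(V)_L$ for large $L$: an invariant vector coming from
    $G_{L \sqcup \{*\}}$ does not see the point $*$, so its class in
    $(\Sigma G/G)_L$ is torsion, and it comes from $G_L$.  This gives the finite
    generation of $S'(V)$, and, applied to the image of $M$ in $S'(T'(M))$, the
    finite length of the cokernel of $M \to S'(T'(M))$.  Its kernel is the torsion
    of $M$, also bounded.  Finally $T'(S'(V)) \to V$ is bijective because each
    vector of an algebraic representation is fixed by the pointwise stabilizer of
    some finite set. *)

Set Implicit Arguments.
Unset Strict Implicit.
Unset Printing Implicit Defensive.

Import GRing.Theory.
Local Open Scope ring_scope.

Local Obligation Tactic := idtac.

(** * Spans and finite-dimensional subspaces *)

Lemma exists_choice (X Y : Type) (P : X -> Y -> Prop) :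
  (forall x, exists y, P x y) -> exists f : X -> Y, forall x, P x (f x).
Proof. by move=> /choice[f fP]; exists f. Qed.

Section Span.
Variables (k : fieldType) (V : lmodType k).

Inductive lspan (P : V -> Prop) : V -> Prop :=
| lspan0 : lspan P 0
| lspanS a v w : P v -> lspan P w -> lspan P (a *: v + w).

Definition subspace (Q : V -> Prop) : Prop :=
  Q 0 /\ forall a v w, Q v -> Q w -> Q (a *: v + w).

Lemma subspaceB Q v w : subspace Q -> Q v -> Q w -> Q (v - w).
Proof. by move=> [_ Ql] Qv Qw; rewrite addrC -scaleN1r; apply: Ql. Qed.

Lemma lspan_min (P Q : V -> Prop) : subspace Q -> (forall v, P v -> Q v) ->
  forall v, lspan P v -> Q v.
Proof. by move=> [Q0 Ql] PQ v; elim=> // a {}v w /PQ Qv _; exact: Ql. Qed.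

Lemma lspan_subspace (P : V -> Prop) : subspace (lspan P).
Proof.
split=> [|a v w]; first exact: lspan0.
elim=> [|b {}v u Pv _ IH] Pw; first by rewrite scaler0 add0r.
by rewrite scalerDr scalerA -addrA; apply: lspanS => //; exact: IH.
Qed.

Lemma lspan_mem (P : V -> Prop) v : P v -> lspan P v.
Proof.
move=> Pv; rewrite -[v]addr0 -[v]scale1r; apply: lspanS => //; exact: lspan0.
Qed.

Lemma lspan_mono (P Q : V -> Prop) : (forall v, P v -> Q v) ->
  forall v, lspan P v -> lspan Q v.
Proof.
move=> PQ; apply: lspan_min => [|v Pv]; first exact: lspan_subspace.
by apply: lspan_mem; exact: PQ.
Qed.

Lemma lspan_cons v0 (s : seq V) v : lspan (fun u => u \in v0 :: s) v ->
  exists a, lspan (fun u => u \in s) (v - a *: v0).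
Proof.
have [l0 ll] := lspan_subspace (fun u => u \in s).
elim=> [|a {}v w]; first by exists 0; rewrite scale0r subr0.
rewrite inE => vs _ [b IH].
case/orP: vs => [/eqP ->|vs].
  exists (a + b); rewrite scalerDl opprD addrACA subrr add0r.
  exact: IH.
by exists b; rewrite -addrA; apply: ll => //; exact: lspan_mem.
Qed.

Definition findim (Q : V -> Prop) : Prop :=
  exists s : seq V, forall v, Q v -> lspan (fun u => u \in s) v.

Lemma findim_sub (P Q : V -> Prop) : (forall v, P v -> Q v) ->
  findim Q -> findim P.
Proof. by move=> PQ [s Qs]; exists s => v /PQ/Qs. Qed.

(** A finite set spanning [Q] from outside is exchanged for one inside [Q] by elimination: a vector
    [p] of [Q] with nonzero coefficient at [v0] clears [v0] from all the others, which leaves the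
    part of [Q] spanned by [s]. *)
Lemma findim_spanning (Q : V -> Prop) : subspace Q -> findim Q ->
  exists s : seq V, (forall v, v \in s -> Q v) /\
    forall v, Q v -> lspan (fun u => u \in s) v.
Proof.
move=> Qsub [s]; elim: s Q Qsub => [|v0 s IH] Q Qsub Qs; first by exists [::].
have lsub := lspan_subspace (fun u => u \in s).
have [||s' [s'Q Qs']] := IH (fun v => Q v /\ lspan (fun u => u \in s) v).
- split; first by split; [exact: Qsub.1|exact: lsub.1].
  by move=> a v w [? ?] [? ?]; split; [exact: Qsub.2|exact: lsub.2].
- by move=> v [].
have [[p [a [Qp a0 pa]]]|noP] :=
    pselect (exists p a, [/\ Q p, a != 0 & lspan (fun u => u \in s) (p - a *: v0)]).
  exists (p :: s'); split=> [v|v Qv].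
    by rewrite inE => /orP[/eqP ->//|/s'Q []].
  have [b vb] := lspan_cons (Qs _ Qv).
  rewrite -[v](subrKC ((b / a) *: p)); apply: (lspan_subspace _).2.
    by apply: lspan_mem; rewrite mem_head.
  apply: (@lspan_mono (fun u => u \in s')).
    by move=> u us; rewrite inE us orbT.
  apply: Qs'; split; first by rewrite addrC -scaleNr; exact: Qsub.2.
  have := lsub.2 (- (b / a)) _ _ pa vb.
  by rewrite scalerBr scalerA mulNr mulfVK // !scaleNr opprK -addrA subrKC addrC.
exists s'; split=> [v /s'Q []//|v Qv].
have [b vb] := lspan_cons (Qs _ Qv).
have [b0|b0] := eqVneq b 0.
  by apply: Qs'; split=> //; move: vb; rewrite b0 scale0r subr0.
by case: noP; exists v, b.
Qed.

Lemma findim_acc (P : nat -> V -> Prop) : (forall n, subspace (P n)) ->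
  (forall m n v, (m <= n)%N -> P m v -> P n v) ->
  findim (fun v => exists n, P n v) ->
  exists n, forall m v, P m v -> P n v.
Proof.
move=> Psub Pmono Pfd.
have Usub : subspace (fun v => exists n, P n v).
  split=> [|a v w [m Pv] [n Pw]]; first by exists 0%N; exact: (Psub _).1.
  exists (maxn m n); apply: (Psub _).2.
    by apply: Pmono Pv; exact: leq_maxl.
  by apply: Pmono Pw; exact: leq_maxr.
have [s [sP Ps]] := findim_spanning Usub Pfd.
suff [n sn] : exists n, forall v, v \in s -> P n v.
  exists n => m v Pv; have : exists n, P n v by exists m.
  by move/Ps; apply: lspan_min.
elim: s sP {Ps} => [|v s IH] sP; first by exists 0%N.
have [|m mP] := IH; first by move=> u us; apply: sP; rewrite inE us orbT.
have [n nP] := sP v (mem_head _ _).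
exists (maxn m n) => u; rewrite inE => /orP[/eqP ->|/mP].
  by apply: Pmono nP; exact: leq_maxr.
by apply: Pmono; exact: leq_maxl.
Qed.

(** For a subspace [C]: the image of [B] modulo [C] lies in a space of dimension at most [r].
    Working with representatives avoids quotient spaces. *)
Definition spans_over (C B : V -> Prop) (r : nat) : Prop :=
  exists s : seq V, (size s <= r)%N /\
    forall v, B v -> exists2 w, C w & lspan (fun u => u \in s) (v - w).

(* Steinitz exchange: [c], being nonzero modulo [C], replaces one element of [s]. *)
Lemma lspan_drop (C E : V -> Prop) (s : seq V) c w :
  subspace C -> subspace E -> (forall v, C v -> E v) -> E c -> ~ C c ->
  C w -> lspan (fun u => u \in s) (c - w) ->
  exists2 s' : seq V, (size s' < size s)%N &
    forall v, lspan (fun u => u \in s) v ->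
      exists2 u, E u & lspan (fun u => u \in s') (v - u).
Proof.
move=> Csub Esub CE Ec nCc Cw; elim: s => [|v0 s IH] cw.
  have lnil v : lspan (fun u : V => u \in [::]) v -> v = 0 by case.
  by case: nCc; move/lnil/subr0_eq: cw => ->.
have [a cwa] := lspan_cons cw.
have [a0|a0] := eqVneq a 0.
  have [|s' ss' s'E] := IH; first by move: cwa; rewrite a0 scale0r subr0.
  exists (v0 :: s') => // v /lspan_cons[b /s'E[u Eu vu]].
  exists u => //; have -> : v - u = b *: v0 + (v - b *: v0 - u).
    by rewrite addrA subrKC.
  apply: (lspan_subspace _).2; first by apply: lspan_mem; rewrite mem_head.
  by apply: lspan_mono vu => x xs; rewrite inE xs orbT.
exists s => // v /lspan_cons[b vb]; exists ((b / a) *: (c - w)).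
  rewrite -[_ *: _]addr0; apply: Esub.2 => //; last exact: Esub.1.
  by apply: subspaceB => //; exact: CE.
have := (lspan_subspace (fun u => u \in s)).2 (- (b / a)) _ _ cwa vb.
by rewrite scalerBr scalerA mulNr mulfVK // !scaleNr opprK -addrA subrKC addrC.
Qed.

Lemma spans_over_lt (C E B : V -> Prop) r :
  subspace C -> subspace E -> (forall v, C v -> E v) ->
  (exists c, [/\ E c, B c & ~ C c]) ->
  spans_over C B r -> exists2 r', (r' < r)%N & spans_over E B r'.
Proof.
move=> Csub Esub CE [c [Ec Bc nCc]] [s [sr sB]].
have [w Cw cw] := sB _ Bc.
have [s' ss' s'E] := lspan_drop Csub Esub CE Ec nCc Cw cw.
exists (size s'); first exact: leq_trans ss' sr.
exists s'; split=> // v /sB[w' Cw' /s'E[u Eu vu]].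
exists (w' + u); last by rewrite opprD addrA.
by rewrite -[w']scale1r; apply: Esub.2 => //; exact: CE.
Qed.

End Span.

Section SpanMap.
Variables (k : fieldType) (U V : lmodType k) (f : {linear U -> V}).

Lemma lspan_image (P : U -> Prop) (Q : V -> Prop) :
  (forall u, P u -> Q (f u)) -> forall u, lspan P u -> lspan Q (f u).
Proof.
move=> PQ u; elim=> [|a {}u w Pu _ IH]; first by rewrite linear0; exact: lspan0.
by rewrite linearP; apply: lspanS => //; exact: PQ.
Qed.

Lemma findim_inj (P : U -> Prop) (Q : V -> Prop) : subspace P ->
  injective f -> (forall u, P u -> Q (f u)) -> findim Q -> findim P.
Proof.
move=> [P0 Pl] fI PQ Qfd.
have [||s [sP Ps]] := @findim_spanning _ _ (fun v => exists2 u, P u & v = f u).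
- split=> [|a _ _ [u Pu ->] [w Pw ->]]; first by exists 0; rewrite ?linear0.
  by exists (a *: u + w); rewrite ?linearP //; exact: Pl.
- by apply: findim_sub Qfd => _ [u /PQ Qu ->].
have [t st] : exists t, s = [seq f u | u <- t].
  elim: s sP {Ps} => [|v s IH] sP; first by exists [::].
  have [u _ ->] := sP v (mem_head _ _).
  have [|t ->] := IH; first by move=> x xs; apply: sP; rewrite inE xs orbT.
  by exists (u :: t).
exists t => u Pu.
have : exists2 w, lspan (fun w => w \in t) w & f w = f u.
  have: lspan (fun v => v \in s) (f u) by apply: Ps; exists u.
  elim=> [|a v w vs _ [w' tw' <-]].
    by exists 0; [exact: lspan0|rewrite linear0].
  move: vs; rewrite st => /mapP[x xt ->].
  by exists (a *: x + w'); [exact: lspanS|rewrite linearP].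
by move=> [w tw /fI <-].
Qed.

End SpanMap.

(** * Injections and finitary permutations *)

Section Injections.

Lemma inj_leq_card (L L' : finType) : (#|L| <= #|L'|)%N -> exists f : inj L L', True.
Proof.
move=> LL'; have fI : injective (fun x : L => enum_val (widen_ord LL' (enum_rank x))).
  by move=> x y /enum_val_inj/(congr1 val)/= /val_inj/enum_rank_inj.
by exists (Inj fI).
Qed.

(** An arbitrary injection [h0] is corrected by a permutation of [L'], built from transpositions one
    point of [D] at a time. *)
Lemma inj_extend (D L L' : finType) (f : inj D L) (g : inj D L') :
  (#|L| <= #|L'|)%N -> exists h : inj L L', fi_comp h f = g.
Proof.
move=> /inj_leq_card[h0 _].
suff [p hp] : exists p : {perm L'}, forall x, x \in enum D -> p (h0 (f x)) = g x.
  exists (fi_comp (Inj (@perm_inj _ p)) h0); apply: inj_ext => x /=.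
  by apply: hp; rewrite mem_enum.
elim: (enum D) (enum_uniq D) => [|x s IH] /=; first by exists 1%g.
move=> /andP[xs /IH[p hp]]; exists (p * tperm (p (h0 (f x))) (g x))%g => y.
rewrite inE permM => /orP[/eqP ->|ys]; first by rewrite tpermL.
have yx : y != x by apply: contraNneq xs => <-.
rewrite (hp y) // tpermD //; last first.
  by rewrite eq_sym; move: yx; apply: contra_neq; apply: inj_inj.
rewrite -(hp y) // eq_sym; move: yx; apply: contra_neq => e.
exact: inj_inj (inj_inj (perm_inj e)).
Qed.

Lemma inj_card_eq (L L' : finType) : #|L| = #|L'| ->
  exists (f : inj L L') (g : inj L' L), fi_comp g f = fi_id L /\ fi_comp f g = fi_id L'.
Proof.
move=> e; have [f _] : exists f : inj L L', True by apply: inj_leq_card; rewrite e.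
have [g gf] := @inj_extend L L' L f (fi_id L) (eq_leq (esym e)).
exists f, g; split=> //; apply: inj_ext => x; apply: (@inj_inj _ _ g).
exact: (congr1 (fun h : inj L L => h (g x)) gf).
Qed.

Definition swap_fun (p q i : nat) : nat :=
  if i == p then q else if i == q then p else i.

Lemma swap_funK p q : cancel (swap_fun p q) (swap_fun p q).
Proof.
move=> i; rewrite /swap_fun; case: (eqVneq i p) => [->|ip].
  by rewrite eqxx; case: eqVneq.
by case: (eqVneq i q) => [->|iq]; rewrite ?eqxx // (negPf ip) (negPf iq).
Qed.

Lemma swap_fun_fin p q : exists s : seq nat, forall i, i \notin s -> swap_fun p q i = i.
Proof.
exists [:: p; q] => i; rewrite !inE negb_or /swap_fun => /andP[ip iq].
by rewrite (negPf ip) (negPf iq).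
Qed.

Definition swap (p q : nat) : fperm :=
  FPerm (@swap_funK p q) (@swap_funK p q) (swap_fun_fin p q).

Lemma swapL p q : swap p q p = q.
Proof. by rewrite /= /swap_fun eqxx. Qed.

Lemma swapD p q i : i != p -> i != q -> swap p q i = i.
Proof. by rewrite /= /swap_fun => /negPf-> /negPf->. Qed.

Lemma fperm_transitive (L : finType) (i j : inj L nat) :
  exists s : fperm, fi_comp (fperm_inj s) i = j.
Proof.
suff [s hs] : exists s : fperm, forall x, x \in enum L -> s (i x) = j x.
  by exists s; apply: inj_ext => x; apply: hs; rewrite mem_enum.
elim: (enum L) (enum_uniq L) => [|x r IH] /=; first by exists fperm_id.
move=> /andP[xr /IH[s hs]]; exists (fperm_comp (swap (s (i x)) (j x)) s) => y.
rewrite inE [LHS]/(swap_fun _ _ _) => /orP[/eqP ->|yr]; first exact: swapL.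
have yx : y != x by apply: contraNneq xr => <-.
rewrite (hs y) //; apply: swapD; last by move: yx; apply: contra_neq; apply: inj_inj.
rewrite -(hs y) //; move: yx; apply: contra_neq => e.
exact: inj_inj (inj_inj (e : fperm_inj s _ = fperm_inj s _)).
Qed.

Lemma inj_nat_extend (L L' : finType) (f : inj L L') (i : inj L nat) :
  exists j : inj L' nat, fi_comp j f = i.
Proof.
have j0I : injective (fun x : L' => enum_rank x : nat).
  by move=> x y /val_inj/enum_rank_inj.
have [s hs] := fperm_transitive (fi_comp (Inj j0I) f) i.
by exists (fi_comp (fperm_inj s) (Inj j0I)); rewrite -hs; apply: inj_ext.
Qed.

Lemma inj_nat_amalgam (L L' : finType) (i : inj L nat) (i' : inj L' nat) :
  exists (X : finType) (f : inj L X) (f' : inj L' X) (j : inj X nat),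
    fi_comp j f = i /\ fi_comp j f' = i'.
Proof.
pose X : {fset nat} := [fset x in [seq i x | x <- enum L] ++ [seq i' x | x <- enum L']]%fset.
have iX x : i x \in X by rewrite in_fset mem_cat map_f ?mem_enum.
have i'X x : i' x \in X by rewrite in_fset mem_cat orbC map_f ?mem_enum.
have fI : injective (fun x => [` iX x]%fset : X).
  by move=> x y /(congr1 val) e; exact: inj_inj e.
have fI' : injective (fun x => [` i'X x]%fset : X).
  by move=> x y /(congr1 val) e; exact: inj_inj e.
exists X, (Inj fI), (Inj fI'), (Inj val_inj).
by split; apply: inj_ext.
Qed.

Lemma inl_injective (A B : Type) : injective (@inl A B).
Proof. by move=> x y []. Qed.

Definition fi_inl (A B : Type) : inj A (A + B) := Inj (@inl_injective A B).

Definition sum_map (A B C E : Type) (f : A -> C) (g : B -> E) (x : A + B) : C + E :=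
  match x with inl a => inl (f a) | inr b => inr (g b) end.

Lemma sum_map_inj (A B C E : Type) (f : inj A C) (g : inj B E) :
  injective (sum_map f g).
Proof. by move=> [x|x] [y|y] //= [e]; rewrite (inj_inj e). Qed.

Definition fi_sum (A B C E : Type) (f : inj A C) (g : inj B E) :
  inj (A + B) (C + E) := Inj (@sum_map_inj _ _ _ _ f g).

End Injections.

(** * Finite length *)

Section FImodTheory.
Variable k : fieldType.
Implicit Type M : FImod k.

Lemma sm_subspace M (A : submod M) L : subspace (A L).
Proof. by split=> [|a v w Av Aw]; [exact: sm0|apply: smD => //; exact: smZ]. Qed.

Lemma sm_iso M (A : submod M) (L L' : finType) (f : inj L L') (g : inj L' L) x :
  fi_comp g f = fi_id L -> A L' (fi_map M f x) -> A L x.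
Proof.
by move=> gf /(sm_map g); rewrite -fi_map_comp gf fi_map_id.
Qed.

Lemma sub_ord M (A B : submod M) :
  (forall n x, A 'I_n x -> B 'I_n x) -> sub A B.
Proof.
move=> AB L x Ax; have [f [g [gf _]]] := inj_card_eq (esym (card_ord #|L|)).
by apply: sm_iso gf _; apply: AB; exact: sm_map.
Qed.

(** A strict inclusion lowers [mu], so [n] bounds the number of strict steps from [A'] to [B']. If
    some [C] lies strictly between, both halves get a smaller [n]; otherwise the step is simple. *)
Lemma finite_length_measure M (A B : submod M) (mu : submod M -> nat) :
  (forall C E, sub A C -> sub C E -> sub E B -> ~ sub E C -> (mu E < mu C)%N) ->
  sub A B -> finite_length A B.
Proof.
move=> mu_lt AB.
suff H n A' B' : sub A A' -> sub A' B' -> sub B' B -> (mu A' <= mu B' + n)%N ->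
  finite_length A' B' by exact: (H (mu A)) (leq_addl _ _).
elim: n A' B' => [|n IH] A' B' AA' AB' BB'.
  rewrite addn0 leqNgt => h; apply: finite_length0 => //.
  by apply: contrapT => nBA; move: h; rewrite mu_lt.
move=> h; have [BA|nBA] := pselect (sub B' A'); first exact: finite_length0.
have [[C [A'C CB' nCA nBC]]|noC] := pselect (exists C : submod M,
    [/\ sub A' C, sub C B', ~ sub C A' & ~ sub B' C]).
  have tr (X Y Z : submod M) : sub X Y -> sub Y Z -> sub X Z.
    by move=> XY YZ L x /XY/YZ.
  have lt1 := mu_lt _ _ AA' A'C (tr _ _ _ CB' BB') nCA.
  have lt2 := mu_lt _ _ (tr _ _ _ AA' A'C) CB' BB' nBC.
  apply: (@finite_length_trans _ _ _ C); apply: IH => //.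
  - exact: tr CB' BB'.
  - by rewrite -ltnS -addnS; apply: leq_ltn_trans h _; rewrite ltn_add2r.
  - exact: tr AA' A'C.
  - by rewrite -ltnS -addnS; exact: leq_trans lt1 h.
apply: finite_lengthS (finite_length_refl A') _; split=> // C A'C CB'.
have [|nCA] := pselect (sub C A'); first by left.
right; apply: contrapT => nBC; apply: noC; by exists C.
Qed.

Section Codim.
Variables (V : lmodType k) (B : V -> Prop).

(** The dimension of [B] modulo [C]. The default value 0 is never taken for finite-dimensional [B]
    and a subspace [C]. *)
Definition codim (C : V -> Prop) : nat :=
  if pselect (exists r, `[< spans_over C B r >]) is left h then ex_minn h else 0%N.

Hypothesis Bfd : findim B.

Lemma codimP (C : V -> Prop) : subspace C ->
  spans_over C B (codim C) /\ forall r, spans_over C B r -> (codim C <= r)%N.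
Proof.
move=> Csub; rewrite /codim; case: pselect => [h|[]].
  by case: ex_minnP => m /asboolP ? m_min; split=> // r ?; exact/m_min/asboolP.
have [s Bs] := Bfd; exists (size s); apply/asboolP; exists s; split=> // v Bv.
by exists 0; [exact: Csub.1|rewrite subr0; exact: Bs].
Qed.

Lemma codim_le (C E : V -> Prop) : subspace C -> subspace E ->
  (forall v, C v -> E v) -> (codim E <= codim C)%N.
Proof.
move=> /codimP[[t [tn Bt]] _] /codimP[_ E_min] CE.
by apply: E_min; exists t; split=> // v /Bt[w /CE Ew vw]; exists w.
Qed.

Lemma codim_lt (C E : V -> Prop) : subspace C -> subspace E ->
  (forall v, C v -> E v) -> (exists c, [/\ E c, B c & ~ C c]) ->
  (codim E < codim C)%N.
Proof.
move=> Csub Esub CE EC; have [Cc _] := codimP Csub; have [_ E_min] := codimP Esub.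
have [r rn rE] := spans_over_lt Csub Esub CE EC Cc.
exact: leq_ltn_trans (E_min _ rE) rn.
Qed.

End Codim.

(** The measure adds up the codimensions in [B] over the degrees below [d]. A strict inclusion
    between [A] and [B] shows in one of them, since [A] and [B] agree from degree [d] on. *)
Lemma finite_length_findim M (A B : submod M) d :
  sub A B -> (forall L, findim (B L)) ->
  (forall L : finType, (d <= #|L|)%N -> forall x, B L x -> A L x) ->
  finite_length A B.
Proof.
move=> AB Bfd BA.
pose mu (C : submod M) : nat := (\sum_(j < d) codim (B 'I_j) (C 'I_j))%N.
apply: (@finite_length_measure _ _ _ mu) => // C E AC CE EB nEC.
have [j [c [Ec nCc]]] : exists n (c : M 'I_n), E 'I_n c /\ ~ C 'I_n c.
  apply: contrapT => h; apply: nEC; apply: sub_ord => n x Ex.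
  by apply: contrapT => nCx; apply: h; exists n, x.
have jd : (j < d)%N.
  rewrite ltnNge; apply/negP => dj; apply: nCc; apply: AC; apply: BA.
    by rewrite card_ord.
  exact: EB.
rewrite /mu (bigD1 (Ordinal jd)) //= [ltnRHS](bigD1 (Ordinal jd)) //=.
rewrite -addSn; apply: leq_add.
  apply: codim_lt => //; try exact: sm_subspace; try exact: CE.
  by exists c; split=> //; exact: EB.
apply: leq_sum => i _; apply: codim_le => //; try exact: sm_subspace.
exact: CE.
Qed.

(** Up to isomorphism there is one set in each degree up to [d], and in each of them the chain stays
    inside a finite-dimensional space. *)
Lemma sm_chain_stationary M (Y : nat -> submod M) (B : submod M) d :
  (forall m n, (m <= n)%N -> sub (Y m) (Y n)) ->
  (forall n, sub (Y n) B) -> (forall L, findim (B L)) ->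
  exists n, forall m (L : finType), (#|L| <= d)%N -> forall x, Y m L x -> Y n L x.
Proof.
move=> Ymono YB Bfd.
suff [n hn] : exists n, forall m j, (j <= d)%N -> forall x, Y m 'I_j x -> Y n 'I_j x.
  exists n => m L Ld x Yx.
  have [f [g [gf _]]] := inj_card_eq (esym (card_ord #|L|)).
  by apply: sm_iso gf _; apply: (hn m) => //; exact: sm_map.
have stat j : exists n, forall m x, Y m 'I_j x -> Y n 'I_j x.
  apply: (@findim_acc _ _ (fun n => Y n 'I_j)) => [n|m n x mn|].
  - exact: sm_subspace.
  - exact: Ymono mn _ _.
  - by apply: findim_sub (Bfd 'I_j) => x [n]; exact: YB.
elim: d => [|d [n IH]].
  by have [n hn] := stat 0%N; exists n => m j; rewrite leqn0 => /eqP ->; exact: hn.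
have [n' hn'] := stat d.+1; exists (maxn n n') => m j.
rewrite leq_eqVlt => /orP[/eqP ->|jd] x Yx.
  exact: (Ymono n' _ (leq_maxr _ _) _ _ (hn' _ _ Yx)).
exact: (Ymono n _ (leq_maxl _ _) _ _ (IH _ _ jd _ Yx)).
Qed.

End FImodTheory.

(** * Noetherianity *)

Section Noetherian.
Variable k : fieldType.
Implicit Type M : FImod k.

Definition generated_in_degree M (e : nat) (C : submod M) : Prop :=
  forall X : submod M,
    (forall L : finType, (#|L| <= e)%N -> forall x, C L x -> X L x) -> sub C X.

(* Bounded generation degree stands for finite generation; the two agree for
   modules of finite dimension in each degree. *)
Definition noetherian M (B : submod M) : Prop :=
  forall C : submod M, sub C B -> exists e, generated_in_degree e C.

Lemma noetherian_sub M (A B : submod M) : sub A B -> noetherian B -> noetherian A.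
Proof. by move=> AB Bn C CA; apply: Bn => L x /CA/AB. Qed.

Lemma sm_lin M (A : submod M) L a (x y : M L) : A L x -> A L y -> A L (a *: x + y).
Proof. by move=> Ax Ay; apply: smD => //; exact: smZ. Qed.

Lemma sm_sum M (A : submod M) L (I : finType) (F : I -> M L) :
  (forall i, A L (F i)) -> A L (\sum_i F i).
Proof. by move=> AF; apply: big_ind => //; [exact: sm0|exact: smD]. Qed.

(** For [C] inside [A + B], this stands for the image of [C] in the quotient of [A + B] by [A]. *)
Program Definition sm_proj M (A B C : submod M) : submod M :=
  @Submod k M (fun L b => B L b /\ exists2 a, A L a & C L (a + b)) _ _ _ _.
Next Obligation.
move=> M A B C L; split; first exact: sm0.
by exists 0; rewrite ?addr0; exact: sm0.
Qed.
Next Obligation.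
move=> M A B C L x y [Bx [a Aa Ca]] [By [b Ab Cb]]; split; first exact: smD.
by exists (a + b); [exact: smD|rewrite addrACA; exact: smD].
Qed.
Next Obligation.
move=> M A B C L c x [Bx [a Aa Ca]]; split; first exact: smZ.
by exists (c *: a); [exact: smZ|rewrite -scalerDr; exact: smZ].
Qed.
Next Obligation.
move=> M A B C L L' f x [Bx [a Aa Ca]]; split; first exact: sm_map.
by exists (fi_map M f a); [exact: sm_map|rewrite -linearD; exact: sm_map].
Qed.

Lemma noetherian_add M (A B : submod M) :
  noetherian A -> noetherian B -> noetherian (sm_add A B).
Proof.
move=> An Bn C CAB.
have [|e1 he1] := An (sm_cap A C); first by move=> L x [].
have [|e2 he2] := Bn (sm_proj A B C); first by move=> L x [].
exists (maxn e1 e2) => X XC.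
have AX : sub (sm_cap A C) X.
  by apply: he1 => L Le x [_ Cx]; apply: XC => //; exact: leq_trans (leq_maxl _ _).
(* Using [sm_cap X C] in place of [X] keeps the lifts inside [C], so that the difference between [c]
   and its lift falls into [sm_cap A C]. *)
have BX : sub (sm_proj A B C) (sm_proj A B (sm_cap X C)).
  apply: he2 => L Le x [Bx [a Aa Ca]]; split=> //; exists a => //; split=> //.
  by apply: XC => //; exact: leq_trans Le (leq_maxr _ _).
move=> L c Cc; have [a Aa Bb] := CAB _ _ Cc.
have [|_ [a' Aa' [Xab Cab]]] := BX L (c - a).
  by split=> //; exists a; rewrite // subrKC.
have -> : c = (a - a') + (a' + (c - a)) by rewrite addrA subrK subrKC.
apply: smD => //; apply: AX; split; first exact: smB.
have -> : a - a' = c - (a' + (c - a)) by rewrite opprD opprB addrCA subrKC addrC.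
exact: smB.
Qed.

Program Definition sm_gen1 M (D : finType) (x : M D) : submod M :=
  @Submod k M (fun L => lspan (fun z => exists f : inj D L, z = fi_map M f x)) _ _ _ _.
Next Obligation. by move=> *; exact: lspan0. Qed.
Next Obligation.
move=> M D x L u v Pu Pv; rewrite -[u]scale1r; exact: (lspan_subspace _).2.
Qed.
Next Obligation.
move=> M D x L a u Pu; rewrite -[_ *: _]addr0.
by apply: (lspan_subspace _).2 => //; exact: lspan0.
Qed.
Next Obligation.
move=> M D x L L' f u; apply: lspan_image => _ [g ->].
by exists (fi_comp f g); rewrite fi_map_comp.
Qed.

Program Definition sm_gen M (I : Type) (D : I -> finType) (x : forall i, M (D i))
    (P : I -> Prop) : submod M :=
  @Submod k M (fun L => lspan (fun z => exists i (f : inj (D i) L),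
    P i /\ z = fi_map M f (x i))) _ _ _ _.
Next Obligation. by move=> *; exact: lspan0. Qed.
Next Obligation.
move=> M I D x P L u v Pu Pv; rewrite -[u]scale1r; exact: (lspan_subspace _).2.
Qed.
Next Obligation.
move=> M I D x P L a u Pu; rewrite -[_ *: _]addr0.
by apply: (lspan_subspace _).2 => //; exact: lspan0.
Qed.
Next Obligation.
move=> M I D x P L L' f u; apply: lspan_image => _ [i [g [Pi ->]]].
by exists i, (fi_comp f g); rewrite fi_map_comp.
Qed.

Lemma sm_gen1_mem M (D : finType) (x : M D) : sm_gen1 x D x.
Proof. by apply: lspan_mem; exists (fi_id D); rewrite fi_map_id. Qed.

Lemma sm_gen1_sub M (D : finType) (x : M D) (X : submod M) :
  X D x -> sub (sm_gen1 x) X.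
Proof.
move=> Xx L; apply: lspan_min; first exact: sm_subspace.
by move=> _ [f ->]; exact: sm_map.
Qed.

Section Gen.
Variables (M : FImod k) (I : Type) (D : I -> finType) (x : forall i, M (D i)).

Lemma sm_gen_mem (P : I -> Prop) i : P i -> sm_gen x P (D i) (x i).
Proof. by move=> Pi; apply: lspan_mem; exists i, (fi_id _); rewrite fi_map_id. Qed.

Lemma sm_gen_sub (P : I -> Prop) (X : submod M) :
  (forall i, P i -> X (D i) (x i)) -> sub (sm_gen x P) X.
Proof.
move=> Xx L; apply: lspan_min; first exact: sm_subspace.
by move=> _ [i [f [Pi ->]]]; apply: sm_map; exact: Xx.
Qed.

End Gen.

Lemma sm_gen_noetherian M (I : finType) (D : I -> finType)
    (x : forall i, M (D i)) (P : pred I) :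
  (forall i, P i -> noetherian (sm_gen1 (x i))) -> noetherian (sm_gen x P).
Proof.
move=> xn; suff H (s : seq I) : (forall i, i \in s -> P i) ->
    noetherian (sm_gen x (fun i => i \in s)).
  apply: noetherian_sub (H (enum P) _) => [|i]; last by rewrite mem_enum.
  by apply: sm_gen_sub => i Pi; apply: sm_gen_mem; rewrite mem_enum.
elim: s => [_|i s IH sP].
  move=> C C0; exists 0%N => X _ L y /C0 Cy.
  by move: y Cy {C0}; apply: lspan_min; [exact: sm_subspace|move=> y [? [? []]]].
apply: (@noetherian_sub _ _ (sm_add (sm_gen1 (x i)) (sm_gen x (fun i => i \in s)))).
  apply: sm_gen_sub => j; rewrite inE => /orP[/eqP ->|js].
    by apply: sm_addl; exact: sm_gen1_mem.
  by apply: sm_addr; exact: (sm_gen_mem x (P := fun i => i \in s)).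
apply: noetherian_add; first by apply: xn; apply: sP; rewrite mem_head.
by apply: IH => j js; apply: sP; rewrite inE js orbT.
Qed.

(** The value 0 at non-injective functions puts all translates of [x] into a family indexed by the
    finite type [{ffun D -> L}]. *)
Definition fun_map M (D L : finType) (x : M D) (f : D -> L) : M L :=
  if pselect (injective f) is left h then fi_map M (Inj h) x else 0.

Lemma fun_map_inj M (D L : finType) (x : M D) (f : D -> L) (h : injective f) :
  fun_map x f = fi_map M (Inj h) x.
Proof. by rewrite /fun_map; case: pselect => // h'; apply: fi_map_eq. Qed.

Lemma fun_map_ffun M (D L : finType) (x : M D) (f : inj D L) :
  fun_map x [ffun i => f i] = fi_map M f x.
Proof.
have h : injective [ffun i => f i] by move=> i j; rewrite !ffunE => e; exact: inj_inj e.
by rewrite (fun_map_inj _ h); apply: fi_map_eq => i; rewrite /= ffunE.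
Qed.

Lemma sm_gen_findim M (I : finType) (D : I -> finType) (x : forall i, M (D i))
  (P : I -> Prop) L : findim (sm_gen x P L).
Proof.
exists [seq fun_map (x i) (f : {ffun D i -> L}) | i <- enum I, f <- enum {ffun D i -> L}].
apply: lspan_mono => _ [i [f [_ ->]]]; rewrite -fun_map_ffun.
by apply: allpairs_f_dep; rewrite mem_enum.
Qed.

Lemma sm_gen1_findim M (D : finType) (x : M D) L : findim (sm_gen1 x L).
Proof.
apply: findim_sub (sm_gen_findim (fun _ : unit => x) (fun _ => True) L).
by apply: sm_gen1_sub; exact: (sm_gen_mem (fun _ : unit => x) (i := tt)).
Qed.

Definition reassoc (A B C : Type) (x : A + B + C) : A + (B + C) :=
  match x with
  | inl (inl a) => inl a | inl (inr b) => inr (inl b) | inr c => inr (inr c)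
  end.

Lemma reassoc_inj (A B C : Type) : injective (@reassoc A B C).
Proof. by move=> [[x|x]|x] [[y|y]|y] //= [->]. Qed.

Program Definition shift (E : finType) M : FImod k :=
  @FIMod k (fun L => M (L + E)%type)
    (fun L L' f => fi_map M (fi_sum f (fi_id E))) _ _.
Next Obligation.
by move=> E M L x; rewrite -[RHS]fi_map_id; apply: fi_map_eq => -[].
Qed.
Next Obligation.
by move=> E M L L' L'' g f x; rewrite -fi_map_comp; apply: fi_map_eq => -[].
Qed.

Program Definition sm_shift (E : finType) M (A : submod M) : submod (shift E M) :=
  @Submod k (shift E M) (fun L => A (L + E)%type) _ _ _ _.
Next Obligation. by move=> *; exact: sm0. Qed.
Next Obligation. by move=> *; exact: smD. Qed.
Next Obligation. by move=> *; exact: smZ. Qed.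
Next Obligation. by move=> *; exact: sm_map. Qed.

Section ShiftGen.
Variables (M : FImod k) (D E : finType) (x : M D).

(** An injection of [D] into [L + E] is a map [D -> T + E] followed by an injection of [T] into [L],
    where [T] is the part of [D] sent to [L]. Whatever [L] is, there are finitely many maps
    [D -> T + E]; they give generators of the shift. *)
Definition shift_index := {T : {set D} & {ffun D -> {i | i \in T} + E}}.

Definition shift_dom (t : shift_index) : finType := {i | i \in tag t}.

Definition shift_gen (t : shift_index) : shift E M (shift_dom t) :=
  fun_map x (tagged t).

(** When [h] hits [E], the set [T] is proper: this drop in degree drives the induction in
    [sm_gen1_noetherian]. *)
Lemma inj_sum_factor (L : finType) (h : inj D (L + E)) :
  exists (t : shift_index) (f : inj (shift_dom t) L),
    fi_map M h x = fi_map (shift E M) f (shift_gen t) /\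
    ((exists i e, h i = inr e) -> (#|shift_dom t| < #|D|)%N).
Proof.
pose T := [set i | if h i is inl _ then true else false].
have [f hf] : exists f : {i | i \in T} -> L, forall i, h (val i) = inl (f i).
  apply: (@exists_choice _ _ (fun i l => h (val i) = inl l)) => -[i iT] /=.
  by move: iT; rewrite inE; case: (h i) => // l _; exists l.
have [g hg] : exists g : D -> {i | i \in T} + E, forall i,
    match g i with inl j => val j = i | inr e => h i = inr e end.
  apply: (@exists_choice _ _ (fun i y => match y with inl j => val j = i | inr e => h i = inr e end)).
  move=> i; case hi: (h i) => [l|e]; last by exists (inr e).
  by have iT : i \in T by [rewrite inE hi]; exists (inl (exist _ i iT)).
have fI : injective f.
  move=> i j ij; apply: val_inj; apply: (@inj_inj _ _ h).
  by rewrite !hf ij.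
have hfg i : h i = sum_map f id (g i).
  by have := hg i; case: (g i) => [j <-|e ->].
have gI : injective [ffun i => g i].
  by move=> i j; rewrite !ffunE => ij; apply: (@inj_inj _ _ h); rewrite !hfg ij.
exists (Tagged (fun T : {set D} => {ffun D -> {i | i \in T} + E}) [ffun i => g i]), (Inj fI).
split.
  rewrite /shift_gen /= (fun_map_inj _ gI) -fi_map_comp; apply: fi_map_eq => i /=.
  by rewrite ffunE hfg; case: (g i).
move=> [i [e hi]]; rewrite card_sig; apply: proper_card.
by apply/properP; split; [apply/subsetP|exists i => //; rewrite !inE hi].
Qed.

Program Definition sm_hit : submod (shift E M) :=
  @Submod k (shift E M) (fun L => lspan (fun z => exists h : inj D (L + E),
    (exists i e, h i = inr e) /\ z = fi_map M h x)) _ _ _ _.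
Next Obligation. by move=> *; exact: lspan0. Qed.
Next Obligation.
move=> L u v Pu Pv; rewrite -[u]scale1r; exact: (lspan_subspace _).2.
Qed.
Next Obligation.
move=> L a u Pu; rewrite -[_ *: _]addr0.
by apply: (lspan_subspace _).2 => //; exact: lspan0.
Qed.
Next Obligation.
move=> L L' f u; apply: lspan_image => _ [g [[i [e gi]] ->]].
exists (fi_comp (fi_sum f (fi_id E)) g); split; last by rewrite fi_map_comp.
by exists i, e; rewrite /= gi.
Qed.

Lemma sm_hit_sub :
  sub sm_hit (sm_gen shift_gen (fun t => (#|shift_dom t| < #|D|)%N)).
Proof.
move=> L; apply: lspan_min; first exact: sm_subspace.
move=> _ [h [hit ->]]; have [t [f [-> lt]]] := inj_sum_factor h.
by apply: sm_map; apply: (sm_gen_mem shift_gen (P := fun t => (_ < _)%N)); exact: lt.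
Qed.

Lemma sm_gen1_split (S : finType) w : sm_gen1 x (S + E)%type w ->
  exists m q, [/\ sm_gen1 x S m, sm_hit S q & w = fi_map M (fi_inl S E) m + q].
Proof.
elim=> [|a {}w w' [h ->] _ [m [q [xm Qq ->]]]].
  by exists 0, 0; rewrite linear0 addr0; split=> //; exact: sm0.
have [hit|nohit] := pselect (exists i e, h i = inr e).
  exists m, (a *: fi_map M h x + q); split=> //; last by rewrite addrCA.
  by apply: sm_lin => //; apply: lspan_mem; exists h.
have [f hf] : exists f : D -> S, forall i, h i = inl (f i).
  apply: (@exists_choice _ _ (fun i l => h i = inl l)) => i.
  by case hi: (h i) => [l|e]; [exists l|case: nohit; exists i, e].
have fI : injective f by move=> i j ij; apply: (@inj_inj _ _ h); rewrite !hf ij.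
exists (a *: fi_map M (Inj fI) x + m), q; split=> //.
  by apply: sm_lin => //; apply: lspan_mem; exists (Inj fI).
rewrite linearP -addrA -fi_map_comp; congr (_ *: _ + _).
by apply: fi_map_eq => i; rewrite hf.
Qed.

End ShiftGen.

(** Here the shifting set may change and [f] may move points of [L] into [E']; a translate that hits
    [E] becomes one that hits [E'] as soon as [E] goes to [E']. *)
Lemma sm_hit_map M (D E E' L L' : finType) (x : M D) (f : inj (L + E) (L' + E')) q :
  (forall e, exists e', f (inr e) = inr e') ->
  sm_hit E x L q -> sm_hit E' x L' (fi_map M f q).
Proof.
move=> fE; apply: lspan_image => _ [h [[i [e hi]] ->]].
exists (fi_comp f h); split; last by rewrite fi_map_comp.
by have [e' fe] := fE e; exists i, e'; rewrite /= hi.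
Qed.

Section Decomposition.
Variables (M : FImod k) (D S : finType) (x : M D) (ch : {set S} -> option (inj D S)).

(** [ch] selects one injection for every image. Another injection with the same image is the
    selected one after a permutation of [D], which the coefficient in degree [D] absorbs. *)
Hypothesis chP : forall T, if ch T is Some f then T = [set f i | i in D]
  else forall f : inj D S, T <> [set f i | i in D].

Definition outside (T : {set S}) : finType := {s : S | s \notin T}.

Definition separates (T : {set S}) (f : inj D S) (th : inj S (D + outside T)) : Prop :=
  (forall i, th (f i) = inl i) /\ forall s, s \notin T -> exists e, th s = inr e.

Lemma separates_exists (T : {set S}) (f : inj D S) : T = [set f i | i in D] ->
  exists th, separates (T := T) f th.
Proof.
move=> defT.
have [th hth] : exists th : S -> D + outside T, forall s,
    match th s with inl i => f i = s | inr e => val e = s end.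
  apply: (@exists_choice _ _ (fun s y => match y with inl i => f i = s | inr e => val e = s end)).
  move=> s; have [sT|sT] := boolP (s \in T); last by exists (inr (exist _ s sT)).
  by move: sT; rewrite {1}defT => /imsetP[i _ ->]; exists (inl i).
have thI : injective th.
  move=> s t st; have := hth s; have := hth t; rewrite st.
  by case: (th t) => [i <-|e <-].
exists (Inj thI); split=> [i|s sT] /=.
  have := hth (f i); case: (th (f i)) => [j ji|e ei].
    by rewrite (inj_inj ji).
  have fiT : f i \in T by rewrite defT imset_f.
  by have := valP e; rewrite ei fiT.
have := hth s; case: (th s) => [i fi|e _]; last by exists e.
by case/negP: sT; rewrite -fi defT imset_f.
Qed.

(* [mu T] collects the translates of [x] along the injections with image [T],
   transported to [D] along [ch T]; moving the complement of [T] into the shift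
   turns all the other translates into translates that hit it. *)
Lemma sm_gen1_decomp m : sm_gen1 x S m -> exists mu : {set S} -> M D,
  [/\ forall T, sm_gen1 x D (mu T),
      m = \sum_T (if ch T is Some f then fi_map M f (mu T) else 0)
    & forall T f (th : inj S (D + outside T)), ch T = Some f -> separates f th ->
        sm_hit _ x D (fi_map M th m - fi_map M (fi_inl D _) (mu T))].
Proof.
elim=> [|a _ m' [g ->] _ [mu [xmu m'E Qmu]]].
  exists (fun=> 0); split=> [T||T f th _ _]; first exact: sm0.
    by rewrite big1 // => T _; case: (ch T) => // f; rewrite linear0.
  by rewrite !linear0 addr0; exact: sm0.
set T0 := [set g i | i in D].
have [f0 chT0] : exists f0, ch T0 = Some f0.
  by have := chP T0; case: (ch T0) => [f0 _|/(_ g)//]; exists f0.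
have defT0 : T0 = [set f0 i | i in D] by have := chP T0; rewrite chT0.
have [s hs] : exists s : D -> D, forall i, g i = f0 (s i).
  apply: (@exists_choice _ _ (fun i j => g i = f0 j)) => i.
  have : g i \in T0 by rewrite imset_f.
  by rewrite defT0 => /imsetP[j _ ->]; exists j.
have sI : injective s by move=> i j ij; apply: (@inj_inj _ _ g); rewrite !hs ij.
have gE : fi_map M g x = fi_map M f0 (fi_map M (Inj sI) x).
  by rewrite -fi_map_comp; apply: fi_map_eq.
exists (fun T => if T == T0 then a *: fi_map M (Inj sI) x + mu T else mu T); split.
- move=> T; case: ifP => // _; apply: sm_lin => //.
  by apply: lspan_mem; exists (Inj sI).
- rewrite m'E (bigD1 T0) //= [in RHS](bigD1 T0) //= chT0 eqxx linearP -gE addrA.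
  by congr (_ + _); apply: eq_bigr => T /negPf ->.
move=> T f th chT sep; case: ifP => [/eqP TT0|/negP TT0].
  subst T; rewrite chT0 in chT; case: chT => ?; subst f.
  rewrite [fi_map M th _]linearP [fi_map M (fi_inl D _) _]linearP.
  rewrite opprD addrACA gE -!fi_map_comp.
  rewrite (_ : fi_comp (fi_comp th f0) (Inj sI) = fi_comp (fi_inl D _) (Inj sI)).
    by rewrite subrr add0r; exact: Qmu chT0 sep.
  by apply: inj_ext => i /=; rewrite sep.1.
rewrite linearP -addrA; apply: sm_lin; last exact: Qmu chT sep.
apply: lspan_mem; exists (fi_comp th g); split; last by rewrite fi_map_comp.
(* Otherwise the image of [g] would lie in [T], and both have [#|D|] elements. *)
have [i giT] : exists i, g i \notin T.
  apply: contrapT => h; apply: TT0; rewrite eq_sym eqEcard; apply/andP; split.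
    apply/subsetP => _ /imsetP[i _ ->]; apply: contrapT => giT.
    by apply: h; exists i; exact/negP.
  by have := chP T; rewrite chT => ->; rewrite !card_imset //; exact: inj_inj.
by have [e he] := sep.2 _ giT; exists i, e.
Qed.

End Decomposition.

End Noetherian.

Section NoetherianTheorem.
Variable k : fieldType.
Implicit Type M : FImod k.

(** * Leading parts in a module with one generator *)

Section Step.
Variables (M : FImod k) (D : finType) (x : M D) (W : submod M).
Hypothesis Wx : sub W (sm_gen1 x).

(** The leading parts in degree [D] of elements of [W] shifted by [E], the terms that hit [E] being
    disregarded. By [leading_coef] they control the leading parts in all degrees. *)
Definition leading (E : finType) (m : M D) : Prop :=
  sm_gen1 x D m /\
  exists2 q, sm_hit E x D q & W (D + E)%type (fi_map M (fi_inl D E) m + q).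

Lemma leading_subspace E : subspace (leading E).
Proof.
split; first split; first exact: sm0.
  by exists 0; [exact: sm0|rewrite linear0 addr0; exact: sm0].
move=> a u v [xu [p Qp Wp]] [xv [q Qq Wq]]; split; first exact: sm_lin.
exists (a *: p + q); first exact: (sm_lin a Qp Qq).
by rewrite linearP addrACA -scalerDr; exact: sm_lin.
Qed.

Lemma leading_mono (E E' : finType) m :
  (#|E| <= #|E'|)%N -> leading E m -> leading E' m.
Proof.
move=> /inj_leq_card[f _] [xm [q Qq Wq]]; split=> //.
exists (fi_map M (fi_sum (fi_id D) f) q).
  by apply: sm_hit_map Qq => e; exists (f e).
have := sm_map (fi_sum (fi_id D) f) Wq; rewrite linearD -fi_map_comp.
by rewrite (_ : fi_comp _ _ = fi_inl D E') //; exact: inj_ext.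
Qed.

(** [leading E] depends only on [#|E|], grows with it, and stays inside the finite-dimensional space
    [sm_gen1 x D]. *)
Lemma leading_stationary : exists N, forall E m, leading E m -> leading 'I_N m.
Proof.
have [|m n v mn||N hN] := @findim_acc _ _ (fun n => leading 'I_n).
- by move=> n; exact: leading_subspace.
- by apply: leading_mono; rewrite !card_ord.
- by apply: findim_sub (sm_gen1_findim x D) => m [n []].
- by exists N => E m Em; apply: (hN #|E|); apply: leading_mono Em; rewrite card_ord.
Qed.

(** Along [th] the complement of [T] joins the shift. The translates in [m] whose image is not [T]
    now hit it, and [q] still hits [E], so that only [mu] remains as leading part. The larger shift
    [outside T + E] does no harm once [leading] is stationary. *)
Lemma leading_coef (S E : finType) (T : {set S}) (f : inj D S)
    (th : inj S (D + outside T)) (m : M S) (mu : M D) q :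
  sm_gen1 x D mu -> separates f th ->
  sm_hit _ x D (fi_map M th m - fi_map M (fi_inl D _) mu) ->
  sm_hit E x S q -> W (S + E)%type (fi_map M (fi_inl S E) m + q) ->
  leading (outside T + E)%type mu.
Proof.
move=> xmu sep Qd Qq Ww; split=> //.
pose phi := fi_comp (Inj (@reassoc_inj D (outside T) E)) (fi_sum th (fi_id E)).
pose ka := fi_sum (fi_id D) (fi_inl (outside T) E).
exists (fi_map M ka (fi_map M th m - fi_map M (fi_inl D _) mu) + fi_map M phi q).
  apply: (smD (s := sm_hit _ x)).
    by apply: sm_hit_map Qd => e; exists (inl e).
  by apply: sm_hit_map Qq => e; exists (inr e).
have := sm_map phi Ww; rewrite linearD addrA; congr (W _ (_ + _)).
rewrite linearB addrC -!fi_map_comp.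
rewrite (_ : fi_comp ka (fi_inl _ _) = fi_inl D _); last exact: inj_ext.
rewrite subrK; apply: fi_map_eq => s /=.
by case: (th s).
Qed.

(** An element of large degree is corrected by images of elements of [W] of degree [#|D| + N] with
    the same leading coefficients. The difference has no leading part, hence lies in [C], which is
    generated in bounded degree. *)
Lemma submod_generated_step :
  (forall E, noetherian (sm_hit E x)) -> exists e, generated_in_degree e W.
Proof.
move=> Qn; have [N hN] := leading_stationary.
pose C := sm_cap (sm_shift 'I_N W) (sm_hit 'I_N x).
have [|e1 he1] := Qn 'I_N C; first by move=> L y [].
(* The elements [v T] below live in degree [#|D| + N], and degree [e1] in the shift is degree
   [e1 + N] in [M]. *)
exists (N + maxn #|D| e1)%N => X XW.
have CX : sub C (sm_shift 'I_N X).
  apply: he1 => L Le y [Wy _]; apply: XW => //.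
  rewrite card_sum card_ord addnC leq_add2l.
  exact: leq_trans Le (leq_maxr _ _).
(* Beyond the bound a set has at least [N] elements, so it is isomorphic to some [S + 'I_N]. *)
suff WX (S : finType) w : W (S + 'I_N)%type w -> X (S + 'I_N)%type w.
  move=> L w Ww; have [Le|] := leqP #|L| (N + maxn #|D| e1); first exact: XW.
  move=> /ltnW/(leq_trans (leq_addr _ _)) NL.
  have [|f [g [gf _]]] := @inj_card_eq L ('I_(#|L| - N) + 'I_N)%type.
    by rewrite card_sum !card_ord subnK.
  by apply: sm_iso gf _; apply: WX; exact: sm_map.
move=> Ww; have [m [q [xm Qq wE]]] := sm_gen1_split (Wx Ww).
have [ch chP] : exists ch : {set S} -> option (inj D S), forall T,
    if ch T is Some f then T = [set f i | i in D]
    else forall f : inj D S, T <> [set f i | i in D].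
  apply: (@exists_choice {set S} (option (inj D S)) (fun T o => if o is Some f then T = [set f i | i in D]
    else forall f : inj D S, T <> [set f i | i in D])) => T.
  have [[f ->]|h] := pselect (exists f : inj D S, T = [set f i | i in D]).
    by exists (Some f).
  by exists None => f Tf; apply: h; exists f.
have [mu [xmu mE Qmu]] := sm_gen1_decomp chP xm.
(* The coefficient [mu T] is leading for a larger shift, hence by stationarity already for ['I_N];
   [v T] is an element of [W] that witnesses this. *)
have [v hv] : exists v : {set S} -> M (D + 'I_N)%type, forall T,
    if ch T is Some f then W _ (v T) /\ sm_hit 'I_N x D (v T - fi_map M (fi_inl D _) (mu T))
    else True.
  apply: (@exists_choice {set S} (M (D + 'I_N)%type) (fun T v => if ch T is Some f then W _ v /\
    sm_hit 'I_N x D (v - fi_map M (fi_inl D _) (mu T)) else True)) => T.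
  case chT: (ch T) => [f|]; last by exists 0.
  have defT : T = [set f i | i in D] by have := chP T; rewrite chT.
  have [th sep] := separates_exists defT.
  rewrite wE in Ww.
  have /hN[_ [p Qp Wp]] := leading_coef (xmu T) sep (Qmu _ _ _ chT sep) Qq Ww.
  by exists (fi_map M (fi_inl D _) (mu T) + p); split=> //; rewrite addrC addKr.
pose push T : M (S + 'I_N)%type :=
  if ch T is Some f then fi_map M (fi_sum f (fi_id 'I_N)) (v T) else 0.
have Wpush : W _ (\sum_T push T).
  apply: sm_sum => T; rewrite /push; have := hv T.
  by case: (ch T) => [f [Wv _]|_]; [exact: sm_map|exact: sm0].
have Xpush : X _ (\sum_T push T).
  apply: sm_sum => T; rewrite /push; have := hv T.
  case: (ch T) => [f [Wv _]|_]; last exact: sm0.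
  apply: sm_map; apply: XW => //.
  by rewrite card_sum card_ord addnC leq_add2l leq_maxl.
rewrite -[w](subrK (\sum_T push T)); apply: smD => //.
apply: (CX S); split; first exact: smB.
rewrite wE addrAC; apply: (smD (s := sm_hit 'I_N x)) Qq.
rewrite mE linear_sum -sumrB; apply: (sm_sum (A := sm_hit 'I_N x)) => T.
rewrite /push; have := hv T.
case: (ch T) => [f [_ Qv]|_]; last by rewrite linear0 subrr; exact: sm0.
rewrite -opprB -scaleN1r; apply: (smZ (s := sm_hit 'I_N x)).
have -> : fi_map M (fi_inl S 'I_N) (fi_map M f (mu T)) =
    fi_map M (fi_sum f (fi_id _)) (fi_map M (fi_inl D _) (mu T)).
  by rewrite -!fi_map_comp; apply: fi_map_eq.
by rewrite -linearB; exact: (sm_map f Qv).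
Qed.

End Step.

(** Induction on [#|D|] for all modules at once, because [sm_hit] lives in a shift of [M], inside a
    submodule generated in degrees below [#|D|]. *)
Lemma sm_gen1_noetherian M (D : finType) (x : M D) : noetherian (sm_gen1 x).
Proof.
have [n] := ubnP #|D|; elim: n M D x => // n IH M D x Dn W Wx.
apply: submod_generated_step Wx _ => E.
apply: noetherian_sub (@sm_hit_sub _ _ _ _ _) _.
apply: sm_gen_noetherian => t tD; apply: IH.
by rewrite -ltnS; exact: leq_trans Dn.
Qed.

Lemma sm_gen_finType_noetherian M (I : finType) (D : I -> finType)
  (x : forall i, M (D i)) : noetherian (sm_gen x (fun=> True)).
Proof.
apply: noetherian_sub (sm_gen_noetherian (x := x) (P := fun=> true) _) => [|i _].
  by apply: sm_gen_sub => i _; exact: (sm_gen_mem x (P := fun=> true)).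
exact: sm_gen1_noetherian.
Qed.

Section ShiftFinType.
Variables (M : FImod k) (I : finType) (D : I -> finType) (x : forall i, M (D i)).
Variable E : finType.

Lemma sm_shift_gen_sub : sub (sm_shift E (sm_gen x (fun=> True)))
  (sm_gen (fun t : {i : I & shift_index (D i) E} =>
     shift_gen (x (tag t)) (tagged t)) (fun=> True)).
Proof.
move=> L; apply: lspan_min; first exact: sm_subspace.
move=> _ [i [h [_ ->]]].
have [t [f [-> _]]] := inj_sum_factor (x i) h.
apply: sm_map.
exact: (@sm_gen_mem _ (shift E M) _ _ (fun t : {i : I & shift_index (D i) E} =>
  shift_gen (x (tag t)) (tagged t)) (fun=> True) (Tagged (fun i => shift_index (D i) E) t) Logic.I).
Qed.

Lemma sm_shift_noetherian : noetherian (sm_shift E (sm_gen x (fun=> True))).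
Proof.
apply: noetherian_sub sm_shift_gen_sub _; exact: sm_gen_finType_noetherian.
Qed.

End ShiftFinType.

(** * Bounded torsion *)

(** These submodules form a chain whose union is the torsion of [B] modulo [A]; each member vanishes
    modulo [A] from degree [n] on. *)
Program Definition sm_dead M (A B : submod M) (n : nat) : submod M :=
  @Submod k M (fun L x => B L x /\ forall (L' : finType) (f : inj L L'),
     (n <= #|L'|)%N -> A L' (fi_map M f x)) _ _ _ _.
Next Obligation.
by move=> M A B n L; split=> [|L' f _]; rewrite ?linear0; exact: sm0.
Qed.
Next Obligation.
move=> M A B n L x y [Bx Ax] [By Ay]; split=> [|L' f nL']; first exact: smD.
by rewrite linearD; apply: smD; [exact: Ax|exact: Ay].
Qed.
Next Obligation.
move=> M A B n L a x [Bx Ax]; split=> [|L' f nL']; first exact: smZ.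
by rewrite linearZ; apply: smZ; exact: Ax.
Qed.
Next Obligation.
move=> M A B n L L' f x [Bx Ax]; split=> [|L'' g nL'']; first exact: sm_map.
by rewrite -fi_map_comp; exact: Ax.
Qed.

Program Definition sm_torsion M (A B : submod M) : submod M :=
  @Submod k M (fun L x => exists n, sm_dead A B n L x) _ _ _ _.
Next Obligation. by move=> M A B L; exists 0%N; exact: sm0. Qed.
Next Obligation.
have mono M (A B : submod M) m n : (m <= n)%N -> sub (sm_dead A B m) (sm_dead A B n).
  by move=> mn L x [Bx Ax]; split=> // L' f nL'; apply: Ax; exact: leq_trans nL'.
move=> M A B L x y [m Ax] [n Ay]; exists (maxn m n); apply: smD.
  by apply: mono Ax; exact: leq_maxl.
by apply: mono Ay; exact: leq_maxr.
Qed.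
Next Obligation. by move=> M A B L a x [n Ax]; exists n; exact: smZ. Qed.
Next Obligation. by move=> M A B L L' f x [n Ax]; exists n; exact: sm_map. Qed.

(** By noetherianity the torsion is generated in degrees up to some [e]. In these degrees the chain
    [sm_dead A B n] is stationary, so a single [n] serves for all of the torsion. *)
Lemma torsion_bounded M (A B : submod M) :
  noetherian B -> (forall L, findim (B L)) ->
  exists d, forall L : finType, (d <= #|L|)%N -> forall x, B L x ->
    (exists (L' : finType) (f : inj L L'), A L' (fi_map M f x)) -> A L x.
Proof.
move=> Bn Bfd; have [|e he] := Bn (sm_torsion A B); first by move=> L x [n []].
have mono m n : (m <= n)%N -> sub (sm_dead A B m) (sm_dead A B n).
  by move=> mn L x [Bx Ax]; split=> // L' f nL'; apply: Ax; exact: leq_trans nL'.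
have deadB n : sub (sm_dead A B n) B by move=> L x [].
have [n hn] := sm_chain_stationary e mono deadB Bfd.
exists n => L nL x Bx [L' [f Ax]].
have [_ Adead] : sm_dead A B n L x.
  apply: he => [X Xe y [m ym]|]; first exact: hn ym.
  (* Once [f] sends [y] into [A], so does every injection into a set of at least [#|L'|] elements,
     since it factors through [f]. *)
  exists #|L'|; split=> // L'' g L'L''; have [h <-] := inj_extend f g L'L''.
  by rewrite fi_map_comp; exact: sm_map.
by have := Adead L (fi_id L) nL; rewrite fi_map_id.
Qed.

End NoetherianTheorem.

(** * Finite generation and generation in bounded degree *)

Section FinitelyGenerated.
Variable k : fieldType.
Implicit Type M : FImod k.

Lemma finitely_generated_finType M (I : finType) (D : I -> finType)
    (x : forall i, M (D i)) :
  (forall X : submod M, (forall i, X (D i) (x i)) -> sub (sm_full M) X) ->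
  finitely_generated M.
Proof.
move=> h; exists #|I|, (fun i => D (enum_val i)), (fun i => x (enum_val i)) => X Xx.
by apply: h => i; rewrite -(enum_rankK i).
Qed.

Lemma finitely_generated_noetherian M :
  finitely_generated M -> noetherian (sm_full M).
Proof.
move=> [r [D [x h]]]; apply: noetherian_sub (@sm_gen_finType_noetherian _ _ _ _ x).
by apply: h => i; exact: (sm_gen_mem x (P := fun=> True)).
Qed.

Lemma finitely_generated_findim M L :
  finitely_generated M -> findim (fun _ : M L => True).
Proof.
move=> [r [D [x h]]]; apply: findim_sub (sm_gen_findim x (fun=> True) L).
move=> y _; apply: (h (sm_gen x (fun=> True))) => // i.
exact: (sm_gen_mem x (P := fun=> True)).
Qed.

Lemma finitely_generated_degree M e : (forall L, findim (fun _ : M L => True)) ->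
  generated_in_degree e (sm_full M) -> finitely_generated M.
Proof.
move=> Mfd he.
have [s hs] : exists s : forall n, seq (M 'I_n), forall n x, lspan (fun y => y \in s n) x.
  exists (fun n => projT1 (cid (Mfd 'I_n))) => n x.
  by case: cid => /= t; apply.
apply: (@finitely_generated_finType _ {n : 'I_e.+1 & 'I_(size (s n))}
  (fun t => 'I_(tag t)) (fun t => (s (tag t))`_(tagged t))) => X Xs.
apply: he => L Le x _.
have [f [g [gf _]]] := inj_card_eq (esym (card_ord #|L|)).
apply: sm_iso gf _; move: (fi_map M f x).
have Le1 : (#|L| < e.+1)%N by [].
move=> y; apply: (lspan_min _ _ (hs _ y)); first exact: sm_subspace.
move=> z zs; rewrite -(nth_index 0 zs).
have zs' : (index z (s #|L|) < size (s #|L|))%N by rewrite index_mem.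
exact: (Xs (Tagged (fun n : 'I_e.+1 => 'I_(size (s n))) (Ordinal zs' : 'I_(size (s (Ordinal Le1)))))).
Qed.

End FinitelyGenerated.

Section Fperm.

Lemma fperm_ext (s t : fperm) : s =1 t -> s = t.
Proof.
move=> st; have : pinv s = pinv t.
  by apply/funext => i; rewrite -[in LHS](pinvK t i) -st pfunK.
case: s t st => [s s' sK s'K sf] [t t' tK t'K tf] /= /funext st st'.
case: _ / st in tK t'K tf *; case: _ / st' in tK t'K *.
by congr FPerm; exact: Prop_irrelevance.
Qed.

Lemma fperm_inv_fin (s : fperm) :
  exists r : seq nat, forall i, i \notin r -> pinv s i = i.
Proof.
have [r hr] := pfun_fin s; exists r => i ir.
by rewrite -[in LHS](hr i ir) pfunK.
Qed.

Definition fperm_inv (s : fperm) : fperm :=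
  FPerm (pinvK s) (pfunK s) (fperm_inv_fin s).

Lemma inj_nat_exists (L : finType) : exists i : inj L nat, True.
Proof.
by have [i _] := @inj_nat_extend _ L (fi_id L) (Inj (inj_comp val_inj enum_rank_inj)); exists i.
Qed.

(** Points are adjoined one by one because the descent in [exhausts_large] removes them one by
    one. *)
Fixpoint adjoin (L : finType) (n : nat) : finType :=
  if n is n'.+1 then (adjoin L n' + unit)%type else L.

Fixpoint fi_adjoin (L : finType) (n : nat) : inj L (adjoin L n) :=
  if n is n'.+1 return inj L (adjoin L n)
  then fi_comp (fi_inl (adjoin L n') unit) (fi_adjoin L n') else fi_id L.

Lemma card_adjoin (L : finType) n : #|adjoin L n| = (#|L| + n)%N.
Proof.
elim: n => [|n IH] /=; first by rewrite addn0.
by rewrite card_sum card_unit IH addn1 addnS.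
Qed.

End Fperm.

(** * Invariant families *)

Section InvariantFamilies.
Variables (k : fieldType) (V : rep k).
Local Notation S := (Sprime_ob V).

Definition family_at (L : finType) (i : inj L nat) (m : S L) : V := inv_fun m i.

Fact family_at_linear (L : finType) (i : inj L nat) : linear (family_at i).
Proof. by []. Qed.

HB.instance Definition _ (L : finType) (i : inj L nat) :=
  GRing.isLinear.Build k (S L) V *:%R (family_at i) (family_at_linear i).

Lemma family_at_map (L L' : finType) (f : inj L L') (i : inj L' nat) (m : S L) :
  family_at i (fi_map S f m) = family_at (fi_comp i f) m.
Proof. by []. Qed.

Lemma family_at_fixed (L : finType) (i : inj L nat) (m : S L) (s : fperm) :
  (forall x, s (i x) = i x) -> ract V s (family_at i m) = family_at i m.
Proof. by have /asboolP[m1 _] := inv_funP m; exact: m1. Qed.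

Lemma family_at_act (L : finType) (i : inj L nat) (m : S L) (s : fperm) :
  family_at (fi_comp (fperm_inj s) i) m = ract V s (family_at i m).
Proof. by have /asboolP[_ m2] := inv_funP m; exact: m2. Qed.

Lemma family_at_inj (L : finType) (i : inj L nat) : injective (family_at i).
Proof.
move=> m m' mm'; apply: val_inj; apply/funext => j.
have [s <-] := fperm_transitive i j.
by have := congr1 (ract V s) mm'; rewrite -!family_at_act.
Qed.

Lemma Sprime_map_inj (L L' : finType) (f : inj L L') : injective (fi_map S f).
Proof.
move=> m m' mm'; have [j _] := inj_nat_exists L'.
by apply: (@family_at_inj _ (fi_comp j f)); rewrite -!family_at_map mm'.
Qed.

(** The member at [s] after [i] has to be [s v]; this depends only on the injection, because the
    stabilizer of [i] fixes [v], and by transitivity it defines the whole family. *)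
Lemma family_exists (L : finType) (i : inj L nat) (v : V) :
  (forall s : fperm, (forall x, s (i x) = i x) -> ract V s v = v) ->
  exists m : S L, family_at i m = v.
Proof.
move=> vfix.
have ract_eq (s t : fperm) :
    fi_comp (fperm_inj s) i = fi_comp (fperm_inj t) i -> ract V s v = ract V t v.
  move=> st; have stx x : s (i x) = t (i x) := congr1 (fun h : inj L nat => h x) st.
  rewrite (_ : s = fperm_comp t (fperm_comp (fperm_inv t) s)).
    by rewrite ract_comp [X in ract V t X]vfix // => x /=; rewrite stx pfunK.
  by apply: fperm_ext => x /=; rewrite pinvK.
have [m0 hm0] : exists m0 : inj L nat -> V, forall s,
    m0 (fi_comp (fperm_inj s) i) = ract V s v.
  exists (fun j => ract V (projT1 (cid (fperm_transitive i j))) v) => s.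
  by apply: ract_eq; case: cid.
have m0P : m0 \in @inv_family_pred k V L.
  apply/asboolP; split=> j s; have [t <-] := fperm_transitive i j.
    move=> sj; rewrite hm0 -ract_comp; apply: ract_eq.
    by apply: inj_ext => x; exact: sj.
  rewrite (_ : fi_comp _ (fi_comp _ i) = fi_comp (fperm_inj (fperm_comp s t)) i).
    by rewrite !hm0 ract_comp.
  exact: inj_ext.
exists (InvSpace m0P); rewrite /family_at /= -[RHS]ract_id -hm0.
by congr m0; exact: inj_ext.
Qed.

Definition exhausts (G : submod S) : Prop :=
  forall v, exists (L : finType) (i : inj L nat) (m : S L), G L m /\ family_at i m = v.

Lemma exhausted_subspace (G : submod S) :
  subspace (fun v => exists (L : finType) (i : inj L nat) (m : S L),
    G L m /\ family_at i m = v).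
Proof.
split.
  have [i _] := inj_nat_exists void.
  by exists void, i, 0; split; [exact: sm0|rewrite linear0].
move=> a _ _ [L [i [m [Gm <-]]]] [L' [i' [m' [Gm' <-]]]].
have [X [f [f' [j [<- <-]]]]] := inj_nat_amalgam i i'.
exists X, j, (a *: fi_map S f m + fi_map S f' m'); split.
  by apply: sm_lin; exact: sm_map.
by rewrite linearP.
Qed.

Section Generated.
Variables (I : finType) (D : I -> finType) (y : forall i, S (D i)).
Local Notation G := (sm_gen y (fun=> True)).
Hypothesis Gexh : exhausts G.

(** The copy of [G] inside its shift by one point; [torsion_bounded] is applied to the shift of [G]
    modulo this copy. *)
Program Definition sm_inl : submod (shift unit S) :=
  @Submod k (shift unit S)
    (fun L z => exists2 m, G L m & z = fi_map S (fi_inl L unit) m) _ _ _ _.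
Next Obligation. by move=> L; exists 0; [exact: sm0|rewrite linear0]. Qed.
Next Obligation.
move=> L _ _ [m Gm ->] [m' Gm' ->]; exists (m + m'); first exact: smD.
by rewrite linearD.
Qed.
Next Obligation.
move=> L a _ [m Gm ->]; exists (a *: m); first exact: smZ.
by rewrite linearZ.
Qed.
Next Obligation.
move=> L L' f _ [m Gm ->]; exists (fi_map S f m); first exact: sm_map.
transitivity (fi_map S (fi_comp (fi_sum f (fi_id unit)) (fi_inl L unit)) m); first by rewrite fi_map_comp.
rewrite -fi_map_comp; congr (fi_map S _ m); exact: inj_ext.
Qed.

Lemma exhausts_large :
  exists d, forall L : finType, (d <= #|L|)%N -> forall m : S L, G L m.
Proof.
have [|d hd] := @torsion_bounded _ _ sm_inl _ (@sm_shift_noetherian _ _ _ _ y unit).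
  by move=> L; exact: (sm_gen_findim y (fun=> True) (L + unit)%type).
exists d => L dL m.
have step n (z : S (adjoin L n)) (j : inj (adjoin L n) nat) : G _ z ->
    family_at j z = family_at (fi_comp j (fi_adjoin L n)) m -> G L m.
  elim: n z j => [|n IH] z j Gz zm.
    suff -> : m = z by [].
    by apply: (family_at_inj (i := j)); rewrite zm; congr family_at; exact: inj_ext.
  (* [hd] removes the last point, provided that [z] is torsion modulo [sm_inl]. *)
  have [||z' Gz' zE] := hd (adjoin L n) _ z Gz.
  - by rewrite card_adjoin; exact: leq_trans dL (leq_addr _ _).
  - exists (adjoin L n + unit)%type, (fi_inl _ unit), z => //.
    have [ka kaj] := inj_nat_extend (fi_inl (adjoin L n + unit)%type unit) j.
    apply: (family_at_inj (i := ka)); rewrite [RHS]family_at_map kaj.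
    (* The two images of [z] to be compared use two different copies of the added point. The swap
       [s] carries one copy to the other and fixes the remaining points, hence the vector, which
       already comes from [L]. *)
    pose s := swap (j (inr tt)) (ka (inr tt)).
    have jl t : ka (inl t) = j t := congr1 (fun h : inj (adjoin L n + unit) nat => h t) kaj.
    have sj t : s (j (inl t)) = j (inl t).
      apply: swapD; first by apply/eqP => e; have := inj_inj e.
      by rewrite -jl; apply/eqP => e; have := inj_inj e.
    rewrite [LHS]family_at_map.
    rewrite (_ : fi_comp ka _ = fi_comp (fperm_inj s) j); last first.
      apply: inj_ext => -[t|[]] /=; first by rewrite jl; exact: esym (sj t).
      exact: esym (swapL _ _).
    by rewrite family_at_act zm; apply: family_at_fixed => t; exact: sj.
  apply: (IH z' (fi_comp j (fi_inl _ unit))) => //.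
  have <- : family_at j z = family_at (fi_comp j (fi_inl _ unit)) z' by rewrite zE.
  by rewrite zm; congr family_at; exact: inj_ext.
have [i _] := inj_nat_exists L.
have [L1 [i1 [m1 [Gm1 m1E]]]] := Gexh (family_at i m).
have [X [f [f1 [j [ji ji1]]]]] := inj_nat_amalgam i i1.
(* Adjoining [#|X|] points to [L] leaves room for [X] over [L]. *)
have [|h hf] := @inj_extend _ _ _ f (fi_adjoin L #|X|).
  by rewrite card_adjoin leq_addl.
have [j' j'h] := inj_nat_extend h j.
apply: (step #|X| (fi_map S h (fi_map S f1 m1)) j').
  by do 2!apply: sm_map.
rewrite !family_at_map j'h ji1 m1E -ji -j'h -hf; congr family_at; exact: inj_ext.
Qed.

(** Every space of families embeds into one of large degree, which is all of [G] there. *)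
Lemma exhausts_findim L : findim (fun _ : S L => True).
Proof.
have [d hd] := exhausts_large.
apply: (findim_inj (f := fi_map S (fi_adjoin L d)) (Q := G (adjoin L d))) => //.
- exact: Sprime_map_inj.
- by move=> m _; apply: hd; rewrite card_adjoin leq_addl.
- exact: sm_gen_findim.
Qed.

Lemma exhausts_finitely_generated : finitely_generated S.
Proof.
have [d hd] := exhausts_large.
(* Up to degree [d] everything counts as a generator; beyond it all elements come from the [y i],
   whose degrees the inner maximum bounds. *)
apply: (@finitely_generated_degree _ _ (maxn d (\max_i #|D i|))) => [|X hX L m _].
  exact: exhausts_findim.
have [Ld|dL] := leqP #|L| d.
  by apply: hX => //; exact: leq_trans Ld (leq_maxl _ _).
suff GX : sub G X by apply: GX; apply: hd; exact: ltnW.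
apply: sm_gen_sub => i _; apply: hX => //.
exact: leq_trans (leq_bigmax i) (leq_maxr _ _).
Qed.

End Generated.

End InvariantFamilies.

Section FreeModules.
Variables (k : fieldType) (K : choiceType).

Lemma freeg_span (z : {freeg K / k}) : lspan (fun y => exists b : K, y = << b >>) z.
Proof.
rewrite -[z]freeg_sumE; elim: (dom z) => [|b s IH].
  by rewrite big_nil; exact: lspan0.
rewrite big_cons.
have -> : << coeff b z *g b >> = coeff b z *: << b >> :> {freeg K / k}.
  by apply/eqP/freeg_eqP => x; rewrite coeffZ !coeffU mul1r.
by apply: lspanS => //; exists b.
Qed.

Variables (V : lmodType k) (f : K -> V).

HB.instance Definition _ := GRing.isZmodMorphism.Build
  {freeg K / k} V (fglift f) (lift_is_additive f).

Lemma fglift_linear : linear (fglift f).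
Proof.
move=> a x y; rewrite raddfD /=; congr (_ + _).
rewrite -[x]freeg_sumE scaler_sumr !raddf_sum; apply: eq_bigr => b _ /=.
have -> : a *: << coeff b x *g b >> = << a * coeff b x *g b >> :> {freeg K / k}.
  by apply/eqP/freeg_eqP => z; rewrite coeffZ !coeffU mulrA.
by rewrite !liftU scalerA.
Qed.

End FreeModules.

(** * Germs in the colimit *)

Section Germs.
Variables (k : fieldType) (M : FImod k).

Definition range_fset (L : finType) (i : inj L nat) : {fset nat} :=
  [fset x in [seq i x | x <- enum L]]%fset.

Lemma mem_range_fset (L : finType) (i : inj L nat) x : i x \in range_fset i.
Proof. by rewrite in_fset map_f ?mem_enum. Qed.

Definition corestrict (L : finType) (i : inj L nat) : inj L (range_fset i).
Proof.
exists (fun x => [` mem_range_fset i x]%fset) => x y /(congr1 val) xy.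
exact: inj_inj xy.
Defined.

(** This extends [cin] from finite subsets of [nat] to arbitrary finite sets embedded in [nat]. *)
Definition germ (L : finType) (i : inj L nat) (x : M L) : colim M :=
  cin (fi_map M (corestrict i) x).

Lemma cin_germ (L : finType) (X : {fset nat}) (g : inj L X) (i : inj L nat) (x : M L) :
  (forall l, val (g l) = i l) -> cin (fi_map M g x) = germ i x.
Proof.
move=> gi.
have sX : (range_fset i `<=` X)%fset.
  apply/fsubsetP => b; rewrite in_fset => /mapP[l _ ->].
  by rewrite -gi; exact: valP.
rewrite /germ -(cin_map sX) -fi_map_comp; congr cin.
by apply: fi_map_eq => l; apply: val_inj; rewrite gi.
Qed.

Lemma germ_val (X : {fset nat}) (x : M X) : germ (Inj val_inj) x = cin x.
Proof. by rewrite -(@cin_germ _ X (fi_id X)) // fi_map_id. Qed.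

Lemma germ_map (L L' : finType) (f : inj L L') (i : inj L' nat) (x : M L) :
  germ i (fi_map M f x) = germ (fi_comp i f) x.
Proof. by rewrite {1}/germ -fi_map_comp; exact: cin_germ. Qed.

Lemma cact_germ (s : fperm) (L : finType) (i : inj L nat) (x : M L) :
  cact s (germ i x) = germ (fi_comp (fperm_inj s) i) x.
Proof. by rewrite cact_cin -fi_map_comp; exact: cin_germ. Qed.

Lemma germ_linear (L : finType) (i : inj L nat) : linear (germ i).
Proof. by move=> a x y; rewrite /germ linearP cinD cinZ. Qed.

Lemma germ0 (L : finType) (i : inj L nat) : germ i 0 = 0.
Proof. exact: (linear0 (mk_linear (germ_linear i))). Qed.

Lemma germD (L : finType) (i : inj L nat) x y : germ i (x + y) = germ i x + germ i y.
Proof. exact: (linearD (mk_linear (germ_linear i))). Qed.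

Lemma germZ (L : finType) (i : inj L nat) a x : germ i (a *: x) = a *: germ i x.
Proof. by rewrite -[a *: x]addr0 germ_linear germ0 addr0. Qed.

Lemma germ_eq (L : finType) (i : inj L nat) (x y : M L) : germ i x = germ i y ->
  exists (L' : finType) (f : inj L L'), fi_map M f x = fi_map M f y.
Proof.
move=> /cin_lift[X [h e]].
by exists X, (fi_comp (incl h) (corestrict i)); rewrite !fi_map_comp.
Qed.

Lemma germ_family_subproof (L : finType) (x : M L) :
  (fun i => germ i x) \in @inv_family_pred k (Tprime_ob M) L.
Proof.
apply/asboolP; split=> i s; last by rewrite [RHS]cact_germ.
move=> h; rewrite [LHS]cact_germ; congr (germ _ x); exact: inj_ext.
Qed.

Definition germ_family (L : finType) (x : M L) : Sprime_ob (Tprime_ob M) L :=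
  InvSpace (germ_family_subproof x).

Lemma germ_family_linear (L : finType) : linear (@germ_family L).
Proof. by move=> a x y; apply: val_inj; apply/funext => i; exact: germ_linear. Qed.

Lemma germ_family_nat (L L' : finType) (f : inj L L') (x : M L) :
  germ_family (fi_map M f x) = inv_push f (germ_family x).
Proof. by apply: val_inj; apply/funext => i; exact: germ_map. Qed.

Definition unit_mor : FIhom M (Sprime_ob (Tprime_ob M)) :=
  @FIHom k M (Sprime_ob (Tprime_ob M)) (fun L => mk_linear (@germ_family_linear L))
    germ_family_nat.

Lemma family_at_unit (L : finType) (i : inj L nat) (x : M L) :
  family_at i (unit_mor L x) = germ i x.
Proof. by []. Qed.

End Germs.

(** * The representation $T'(M)$ is algebraic *)

Section TprimeAlgebraic.
Variables (k : fieldType) (M : FImod k).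
Variables (r : nat) (D : 'I_r -> finType) (x : forall j, M (D j)).
Hypothesis xgen : forall X : submod M,
  (forall j, X (D j) (x j)) -> sub (sm_full M) X.
Local Notation n := (fun j => #|D j|).

(* Tuples with repetitions go to [0], so that the whole of [tsum], and not only
   the span of the injective tuples, maps onto [Tprime_ob M]. *)
Definition tuple_germ (b : tbasis n) : Tprime_ob M :=
  if pselect (injective (fun l => tnth (tagged b) (enum_rank l))) is left h
  then germ (Inj h) (x (tag b)) else 0.

Lemma tuple_germ_inj (j : 'I_r) (i : inj (D j) nat) :
  tuple_germ (Tagged (fun j => (n j).-tuple nat) [tuple i (enum_val l) | l < n j])
    = germ i (x j).
Proof.
have tE l : tnth [tuple i (enum_val l) | l < n j] (enum_rank l) = i l.
  by rewrite tnth_mktuple enum_rankK.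
rewrite /tuple_germ; case: pselect => [h|[]] /=.
  by congr (germ _ (x j)); apply: inj_ext => l; exact: tE.
by move=> l l' /=; rewrite !tE => e; exact: inj_inj e.
Qed.

Lemma tuple_germ_act (s : fperm) (b : tbasis n) :
  tuple_germ (tbasis_act s b) = ract (Tprime_ob M) s (tuple_germ b).
Proof.
case: b => j t; rewrite /tuple_germ /=.
have tE l : tnth (map_tuple s t) l = s (tnth t l) by rewrite tnth_map.
case: pselect => [h|nh]; case: pselect => [h'|nh'] /=.
- rewrite [RHS]cact_germ; congr (germ _ (x j)).
  by apply: inj_ext => l; exact: tE.
- by case: nh' => l l' e; apply: h; rewrite !tE e.
- by case: nh => l l'; rewrite !tE => /(@inj_inj _ _ (fperm_inj s))/h'.
- exact: esym (linear0 (ract (Tprime_ob M) s)).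
Qed.

Definition tuple_germ_lift : {linear tsum k n -> Tprime_ob M} :=
  mk_linear (fglift_linear tuple_germ).

Lemma tuple_germ_lift_equiv (s : fperm) z :
  tuple_germ_lift (ract (tsum k n) s z) = ract (Tprime_ob M) s (tuple_germ_lift z).
Proof.
elim: (freeg_span z) => [|a _ w [b ->] _ IH]; first by rewrite !linear0.
rewrite !linearP IH; congr (_ *: _ + _).
by rewrite /= /tsum_act !liftU !scale1r liftU scale1r tuple_germ_act.
Qed.

Definition tuple_germ_rhom : rhom (tsum k n) (Tprime_ob M) :=
  @RHom k (tsum k n) (Tprime_ob M) tuple_germ_lift tuple_germ_lift_equiv.

(** [xgen] applies only to submodules of [M], so surjectivity is tested on the submodule of elements
    all of whose germs are reached. *)
Program Definition sm_germ_hit : submod M :=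
  @Submod k M (fun L y => forall i : inj L nat, exists z, tuple_germ_rhom z = germ i y)
    _ _ _ _.
Next Obligation.
by move=> L i; exists 0; rewrite linear0 germ0.
Qed.
Next Obligation.
move=> L u v hu hv i; have [z zu] := hu i; have [w wv] := hv i.
by exists (z + w); rewrite linearD zu wv germD.
Qed.
Next Obligation.
move=> L a u hu i; have [z zu] := hu i.
by exists (a *: z); rewrite linearZ zu germZ.
Qed.
Next Obligation.
by move=> L L' f u hu i; rewrite germ_map; exact: hu.
Qed.

Lemma tuple_germ_surj v : exists z, tuple_germ_rhom z = v.
Proof.
have [L [y ->]] := cinP v; rewrite -germ_val.
apply: (xgen (X := sm_germ_hit)) => // j i.
exists << Tagged (fun j => (n j).-tuple nat) [tuple i (enum_val l) | l < n j] >>.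
by rewrite /= liftU scale1r tuple_germ_inj.
Qed.

End TprimeAlgebraic.

Lemma Tprime_algebraic (k : fieldType) (M : FImod k) :
  finitely_generated M -> algebraic (Tprime_ob M).
Proof.
move=> [r [D [x xgen]]].
exists r, (fun j => #|D j|), (tsum k _), (rhom_id _), (tuple_germ_rhom x).
by split=> //; exact: tuple_germ_surj.
Qed.

Lemma finitely_generated_inj (k : fieldType) (M N : FImod k) (f : FIhom M N) :
  (forall L, injective (f L)) -> finitely_generated N -> finitely_generated M.
Proof.
move=> fI Nfg.
pose img (X : submod M) := lr_pre (lr_conv (lr_graph f)) X.
have [|e he] := finitely_generated_noetherian Nfg (C := img (sm_full M)) => //.
apply: (finitely_generated_degree (e := e)) => [L|X hX L x _].
  apply: (@findim_inj _ _ _ (f L) (fun=> True) (fun=> True)) => //.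
  exact: finitely_generated_findim.
have [y Xy /= /fI -> //] : img X L (f L x).
  apply: he; last by exists x.
  by move=> L' L'e _ [y _ ->]; exists y => //; exact: hX.
Qed.

(** * Finite generation of $S'(V)$ *)

Section SprimeTsum.
Variables (k : fieldType) (r : nat) (n : 'I_r -> nat).
Local Notation T := (tsum k n).

(** A tuple of natural numbers is a pattern of repetitions, encoded as a word in [c] letters,
    together with an injective naming of the letters. The patterns are finite in number, and each
    gives one family. *)
Definition word_index := {j : 'I_r & {c : 'I_(n j).+1 & {ffun 'I_(n j) -> 'I_c}}}.

Definition word_dom (t : word_index) : finType := 'I_(tag (tagged t)).

Definition word (t : word_index) (i : inj (word_dom t) nat) : tbasis n :=
  Tagged (fun j => (n j).-tuple nat) [tuple i (tagged (tagged t) l) | l < n (tag t)].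

Lemma word_act (t : word_index) (i : inj (word_dom t) nat) (s : fperm) :
  ract T s << word i >> = << word (fi_comp (fperm_inj s) i) >>.
Proof.
rewrite /= /tsum_act liftU scale1r; congr << _ *g Tagged _ _ >>.
by apply: eq_from_tnth => l; rewrite tnth_map !tnth_mktuple.
Qed.

Lemma word_family_subproof (t : word_index) :
  (fun i => << word i >> : T) \in @inv_family_pred k T (word_dom t).
Proof.
apply/asboolP; split=> i s; last by rewrite word_act.
move=> h; rewrite word_act; congr (<< word _ >>); exact: inj_ext.
Qed.

Definition word_family (t : word_index) : Sprime_ob T (word_dom t) :=
  InvSpace (word_family_subproof t).

Lemma word_family_exhausts : exhausts (sm_gen word_family (fun=> True)).
Proof.
move=> z; apply: (@lspan_min _ _ _ _ (@exhausted_subspace _ T _) _ _ (freeg_span z)).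
move=> _ [[j t] ->].
(* The letters are the distinct entries of [t], and [w] below records the position of each entry
   among them. *)
pose u := undup t.
have uj : (size u < (n j).+1)%N by rewrite ltnS (leq_trans (size_undup _)) ?size_tuple.
have iI : injective (fun c : 'I_(size u) => nth 0%N u c).
  by move=> a b /eqP; rewrite nth_uniq ?undup_uniq // => /eqP/val_inj.
have tu l : (index (tnth t l) u < size u)%N by rewrite index_mem mem_undup mem_tnth.
pose w := [ffun l : 'I_(n j) => Ordinal (tu l)].
pose a : word_index := Tagged (fun j => {c : 'I_(n j).+1 & {ffun 'I_(n j) -> 'I_c}})
  (Tagged (fun c : 'I_(n j).+1 => {ffun 'I_(n j) -> 'I_c}) (w : {ffun 'I_(n j) -> 'I_(Ordinal uj)})).
exists (word_dom a), (Inj iI), (word_family a); split.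
  exact: (sm_gen_mem word_family (P := fun=> True)).
rewrite /family_at /=; congr << _ *g Tagged _ _ >>.
apply: eq_from_tnth => l; rewrite tnth_mktuple /= ffunE /=.
by rewrite nth_index // mem_undup mem_tnth.
Qed.

End SprimeTsum.

(** By [family_exists] and [family_at_fixed], this says that every vector is fixed by the pointwise
    stabilizer of a finite subset of [nat]. *)
Definition smooth (k : fieldType) (V : rep k) : Prop := forall v : V,
  exists (L : finType) (i : inj L nat) (m : Sprime_ob V L), family_at i m = v.

Lemma tsum_smooth (k : fieldType) r (n : 'I_r -> nat) : smooth (tsum k n).
Proof.
by move=> v; have [L [i [m [_ mE]]]] := word_family_exhausts v; exists L, i, m.
Qed.

Lemma smooth_inj (k : fieldType) (V W : rep k) (f : rhom V W) :
  injective f -> smooth W -> smooth V.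
Proof.
move=> fI Ws v; have [L [i [m mE]]] := Ws (f v); exists L, i; apply: family_exists.
by move=> s si; apply: fI; rewrite rh_equiv -mE; exact: family_at_fixed.
Qed.

Lemma smooth_surj (k : fieldType) (V W : rep k) (f : rhom V W) :
  (forall w, exists v, f v = w) -> smooth V -> smooth W.
Proof.
move=> fS Vs w; have [v <-] := fS w; have [L [i [m <-]]] := Vs v.
by exists L, i, (Sprime_mor f L m).
Qed.

Lemma algebraic_smooth (k : fieldType) (V : rep k) : algebraic V -> smooth V.
Proof.
move=> [r [n [X [i [q [iI qS]]]]]]; apply: smooth_surj qS _.
by apply: smooth_inj iI _; exact: tsum_smooth.
Qed.

(* [Sprime_ob X] embeds into the noetherian [Sprime_ob (tsum n)]; its image in
   [Sprime_ob V] is finitely generated and exhausts [V]. *)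
Lemma Sprime_finitely_generated (k : fieldType) (V : rep k) :
  algebraic V -> finitely_generated (Sprime_ob V).
Proof.
move=> [r [n [X [i [q [iI qS]]]]]].
have [r' [D [y ygen]]] : finitely_generated (Sprime_ob X).
  apply: (@finitely_generated_inj _ _ _ (Sprime_mor i)).
    move=> L m m' /(congr1 val) mm'; apply: val_inj; apply/funext => j.
    by apply: iI; exact: (congr1 (fun f => f j) mm').
  exact: exhausts_finitely_generated (@word_family_exhausts k r n).
pose z j := Sprime_mor q (D j) (y j).
apply: (@exhausts_finitely_generated _ _ _ D z) => v.
have [x <-] := qS v.
have [L [j [m <-]]] := smooth_inj iI (@tsum_smooth _ _ _) x.
exists L, j, (Sprime_mor q L m); split=> //.
have [|m' Gm' <- //] := ygen (lr_pre (lr_graph (Sprime_mor q)) (sm_gen z (fun=> True))) _ L m Logic.I.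
by move=> l; exists (z l) => //; exact: (sm_gen_mem z (P := fun=> True)).
Qed.

(** * The equivalence *)

Section Unit.
Variables (k : fieldType) (M : FImod k).
Hypothesis Mfg : finitely_generated M.
Local Notation eta := (unit_mor M).

(** The domain of the converse graph is the image of [eta]. It contains the submodule generated by
    the [y j], which exhausts $T'(M)$ because every class there is a germ, and which is therefore
    everything in large degrees. *)
Lemma unit_cofinite :
  finite_length (lr_dom (lr_conv (lr_graph eta))) (sm_full (Sprime_ob (Tprime_ob M))).
Proof.
have [r [D [x xgen]]] := Mfg; pose y j := eta (D j) (x j).
have etay L z : sm_gen y (fun=> True) L (eta L z).
  have [|_ ? <- //] := xgen (lr_pre (lr_graph eta) (sm_gen y (fun=> True))) _ L z Logic.I.
  by move=> j; exists (y j) => //; exact: (sm_gen_mem y (P := fun=> True)).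
have [|d hd] := @exhausts_large _ _ _ _ y.
  move=> v; have [L [z ->]] := cinP v.
  by exists L, (Inj val_inj), (eta L z); rewrite family_at_unit germ_val.
apply: (@finite_length_findim _ _ _ _ d) => // [L|L dL m _].
  by apply: finitely_generated_findim; exact/Sprime_finitely_generated/Tprime_algebraic.
suff GX : sub (sm_gen y (fun=> True)) (lr_dom (lr_conv (lr_graph eta))) by apply: GX; exact: hd.
by apply: sm_gen_sub => j _; exists (x j).
Qed.

(** The indeterminacy of the converse graph is the kernel of [eta]. An element whose germ vanishes
    dies along some injection, so it is torsion and hence zero in large degrees. *)
Lemma unit_kernel_finite :
  finite_length (sm_zero M) (lr_ind (lr_conv (lr_graph eta))).
Proof.
have [|d hd] := torsion_bounded (sm_zero M) (finitely_generated_noetherian Mfg).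
  by move=> L; exact: finitely_generated_findim.
apply: (@finite_length_findim _ _ _ _ d) => [L x ->|L|L dL x hx].
- exact: sm0.
- by apply: findim_sub (finitely_generated_findim L Mfg).
- have x0 := proj1 (lr_indE _ _) hx; apply: hd => //; have [i _] := inj_nat_exists L.
  have [|L' [f fx]] := @germ_eq _ _ _ i x 0.
    by rewrite germ0 -family_at_unit -x0.
  by exists L', f; rewrite fx; exact: linear0.
Qed.

(** In the Serre quotient, [eta] is inverted by reading its graph backwards. *)
Definition unit_inv : Kmor (Sprime_ob (Tprime_ob M)) M :=
  KMor unit_cofinite unit_kernel_finite.

Lemma unit_invK :
  Kmor_eq (Kmor_comp unit_inv (Kmor_of eta)) (Kmor_of (FIhom_id M)).
Proof.
exists (sm_full M), (lr_ind (lr_conv (lr_graph eta))); split.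
- exact: finite_length_refl.
- exact: unit_kernel_finite.
- by move=> L x _; exists x => //; exists (eta L x).
- by move=> L x _; exists x.
- move=> L x y y' _ [_ -> xy] ->; exists 0 => //.
  have {}xy : eta L x = eta L y := xy.
  by change (0 = eta L (y - x)); rewrite linearB xy subrr.
Qed.

Lemma unitK :
  Kmor_eq (Kmor_comp (Kmor_of eta) unit_inv)
    (Kmor_of (FIhom_id (Sprime_ob (Tprime_ob M)))).
Proof.
exists (lr_dom (lr_conv (lr_graph eta))), (sm_zero (Sprime_ob (Tprime_ob M))); split.
- exact: unit_cofinite.
- exact: finite_length_refl.
- by move=> L m [x _ mx]; exists (eta L x) => //; exists x.
- by move=> L m _; exists m.
- by move=> L m n n' _ [x /= -> ->] ->; rewrite subrr.
Qed.

End Unit.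

Lemma Phi_mor_germ (k : fieldType) (M N : FImod k) (G : Kmor M N) (L : finType)
    (i : inj L nat) (x : M L) (y : N L) :
  G L x y -> Phi_mor G (germ i x) = germ i y.
Proof.
move=> Gxy; apply/Phi_funP.
exists (range_fset i), (fi_map M (corestrict i) x), (fi_map N (corestrict i) y).
by split=> //; exact: lr_map.
Qed.

(** Both composites relate [m] to elements of [N] with the same image under the unit, and these
    agree modulo its kernel. *)
Lemma unit_inv_nat (k : fieldType) (M N : FImod k) (Mfg : finitely_generated M)
    (Nfg : finitely_generated N) (G : Kmor M N) :
  Kmor_eq (Kmor_comp (unit_inv Nfg) (Kmor_of (Sprime_mor (Phi_mor G))))
    (Kmor_comp G (unit_inv Mfg)).
Proof.
set G1 := Kmor_comp _ _; set G2 := Kmor_comp _ _.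
exists (sm_cap (lr_dom G1) (lr_dom G2)), (lr_ind (unit_inv Nfg)); split.
- by apply: cofinite_cap; exact: krel_dom.
- exact: krel_ind.
- by move=> L m [].
- by move=> L m [].
- move=> L m n n' _ [_ -> mn] [x mx Gxn']; exists 0 => //.
  change (0 = unit_mor N L (n - n')); rewrite linearB.
  have <- : Sprime_mor (Phi_mor G) L m = unit_mor N L n := mn.
  have -> : m = unit_mor M L x := mx.
  apply/esym/eqP; rewrite subr_eq0; apply/eqP.
  by apply: val_inj; apply/funext => i; exact: Phi_mor_germ.
Qed.

(** * The counit from $T'(S'(V))$ to $V$ *)

Section Counit.
Variables (k : fieldType) (V : rep k).
Local Notation TS := (Tprime_ob (Sprime_ob V)).

Definition counit_fun (z : TS) : V :=
  family_at (Inj val_inj) (tagged (repr (z : colim (Sprime_ob V)))).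

Lemma counit_cin (L : {fset nat}) (m : Sprime_ob V L) :
  counit_fun (cin m) = family_at (Inj val_inj) m.
Proof.
rewrite /counit_fun; move: (cin_repr m); case: (repr (cin m)) => A a /= /cin_eq.
move=> [C [sAC [LC e]]]; have := congr1 (family_at (Inj val_inj)) e.
rewrite !family_at_map.
rewrite (_ : fi_comp _ (incl sAC) = Inj val_inj); last exact: inj_ext.
by rewrite (_ : fi_comp _ (incl LC) = Inj val_inj); last exact: inj_ext.
Qed.

Lemma counit_linear : linear counit_fun.
Proof.
move=> a x y; have [L [u [v [-> ->]]]] := cinP2 x y.
by rewrite -cinZ -cinD !counit_cin linearP.
Qed.

Lemma counit_equiv s z : counit_fun (ract TS s z) = ract V s (counit_fun z).
Proof.
have [L [m ->]] := cinP z; rewrite /= cact_cin !counit_cin family_at_map -family_at_act.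
by congr (family_at _ m); exact: inj_ext.
Qed.

Definition counit : rhom TS V := @RHom k TS V (mk_linear counit_linear) counit_equiv.

Lemma counit_inj : injective counit.
Proof.
move=> z z'; have [L [m [m' [-> ->]]]] := cinP2 z z'.
by rewrite /= !counit_cin => /family_at_inj ->.
Qed.

Lemma counit_surj : smooth V -> forall v, exists z, counit z = v.
Proof.
move=> Vs v; have [L [i [m <-]]] := Vs v; exists (germ i m).
rewrite /= counit_cin family_at_map; congr (family_at _ m); exact: inj_ext.
Qed.

End Counit.

Lemma counit_nat (k : fieldType) (V W : rep k) (f : rhom V W) z :
  counit W (Tprime_mor (Sprime_mor f) z) = f (counit V z).
Proof. by have [L [m ->]] := cinP z; rewrite /= cmap_cin !counit_cin. Qed.

Lemma rhom_inverse (k : fieldType) (V W : rep k) (f : rhom V W) :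
  injective f -> (forall w, exists v, f v = w) ->
  exists g : rhom W V, cancel f g /\ cancel g f.
Proof.
move=> fI /exists_choice[g gK].
have glin : linear g by move=> a u v; apply: fI; rewrite linearP !gK.
have geq s v : mk_linear glin (ract W s v) = ract V s (mk_linear glin v).
  by apply: fI; rewrite rh_equiv /= !gK.
by exists (@RHom k W V (mk_linear glin) geq); split=> v //=; apply: fI; rewrite gK.
Qed.

Theorem mainTheorem16 (R : realType) :
  exists (hT : forall M : FImod (complex R),
            finitely_generated M -> algebraic (Tprime_ob M))
         (hS : forall V : rep (complex R),
            algebraic V -> finitely_generated (Sprime_ob V)),
    mutually_quasi_inverse (Phi hT) (Psi hS).
Proof.
exists (@Tprime_algebraic _), (@Sprime_finitely_generated _); split.
  have inv (V : Rep (complex R)) :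
      exists g : rhom (sval V) (Tprime_ob (Sprime_ob (sval V))),
        cancel (counit (sval V)) g /\ cancel g (counit (sval V)).
    apply: rhom_inverse; first exact: counit_inj.
    by apply: counit_surj; exact: algebraic_smooth (svalP V).
  exists (fun V : Rep (complex R) => counit (sval V)), (fun V => projT1 (cid (inv V))).
  split=> [V W f z|V|V].
  (* [Psi] passes through [Tq], and on morphisms coming from there [Phi] is $T'$. *)
  - exact: etrans (congr1 (counit (sval W)) (Phi_mor_of _ z)) (counit_nat f z).
  - by case: cid => g [].
  - by case: cid => g [].
(* The isomorphism goes from $S'(T'(M))$ to $M$, so [unit_inv] is the forward map and the unit its
   inverse. *)
exists (fun M : ModK (complex R) => unit_inv (svalP M)),
  (fun M : ModK (complex R) => Kmor_of (unit_mor (sval M))).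
split=> [M N G|M|M].
- exact: unit_inv_nat.
- exact: unitK.
- exact: unit_invK.
Qed.
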